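(* Let $G$ be a permutation group of odd order on a finite set $\Omega$. Then the generalized base number of the coherent configuration $\mathrm{Inv}(G)$ is at most $1$, i.e. $gb(\mathrm{Inv}(G))\le 1$.
   Context: A coherent configuration on a finite set $\Omega$ is a pair $\mathcal X=(\Omega,S)$ where $S$ is a partition of $\Omega\times\Omega$ such that the diagonal $1_\Omega$ is a union of elements of $S$, $s^*=\{(\beta,\alpha):(\alpha,\beta)\in s\}\in S$ for every $s\in S$, and for all $r,s,t\in S$ the number $c_{rs}^t=|\{\gamma:(\alpha,\gamma)\in r,(\gamma,\beta)\in s\}|$ does not depend on $(\alpha,\beta)\in t$. Elements of $S$ are basic relations, their unions are relations. A fiber is a set $\Gamma\subseteq\Omega$ with $1_\Gamma=\{(\gamma,\gamma):\gamma\in\Gamma\}\in S$. $\mathcal X\le \mathcal X'$ (fission) means every relation of $\mathcal X$ is a relation of $\mathcal X'$. $\mathcal X$ is complete if every basic relation is a singleton. For $\Pi\subseteq 2^\Omega$, the $\Pi$-fission of $\mathcal X$ is the smallest fission of $\mathcal X$ in which every element of $\Pi$ is a union of fibers; $\Pi$ is a generalized base of $\mathcal X$ if the $\Pi$-fission is complete, and $gb(\mathcal X)$ is the minimum size of a generalized base. For $G\le \mathrm{Sym}(\Omega)$, $\mathrm{Inv}(G)=(\Omega,S)$ with $S$ the set of orbits of $G$ acting componentwise on $\Omega\times\Omega$. *)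

(* Defs.v *)
From mathcomp Require Import all_boot all_fingroup.
Set Implicit Arguments. Unset Strict Implicit. Unset Printing Implicit Defensive.

Section CC.
Variable T : finType.

Definition diagT : {set T * T} := [set x | x.1 == x.2].
Definition diag_of (D : {set T}) : {set T * T} := [set (x, x) | x in D].

Definition transp (s : {set T * T}) : {set T * T} := [set x | (x.2, x.1) \in s].

Definition cnum (r s : {set T * T}) (a b : T) : nat :=
  #|[set c | ((a, c) \in r) && ((c, b) \in s)]|.

Definition is_rel (S : {set {set T * T}}) (r : {set T * T}) : bool :=
  [exists P : {set {set T * T}}, (P \subset S) && (cover P == r)].

(* S is (the set of basic relations of) a coherent configuration on T *)
Definition is_cc (S : {set {set T * T}}) : bool :=
  [&& partition S [set: T * T],
      is_rel S diagT,
      [forall s in S, transp s \in S] &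
      [forall r in S, forall s in S, forall t in S, forall x in t, forall y in t,
          cnum r s x.1 x.2 == cnum r s y.1 y.2]].

Definition fission (S S' : {set {set T * T}}) : bool :=
  [forall r : {set T * T}, is_rel S r ==> is_rel S' r].

Definition is_fiber (S : {set {set T * T}}) (D : {set T}) : bool :=
  diag_of D \in S.

Definition fiber_union (S : {set {set T * T}}) (D : {set T}) : bool :=
  [exists F : {set {set T}}, [forall E in F, is_fiber S E] && (cover F == D)].

Definition complete (S : {set {set T * T}}) : bool :=
  [forall s in S, #|s| == 1].

Definition Pi_fission (S : {set {set T * T}}) (Pi : {set {set T}})
    (S' : {set {set T * T}}) : bool :=
  [&& is_cc S', fission S S', [forall D in Pi, fiber_union S' D] &
      [forall S'' : {set {set T * T}},
         [&& is_cc S'', fission S S'' & [forall D in Pi, fiber_union S'' D]]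
         ==> fission S' S'']].

Definition gen_base (S : {set {set T * T}}) (Pi : {set {set T}}) : bool :=
  [exists S' : {set {set T * T}}, Pi_fission S Pi S' && complete S'].

(* minimum size of a generalized base (#|{set T}| bounds every #|Pi|) *)
Definition gb (S : {set {set T * T}}) : nat :=
  \big[minn/#|{set T}|]_(Pi : {set {set T}} | gen_base S Pi) #|Pi|.

Definition Inv (G : {set {perm T}}) : {set {set T * T}} :=
  [set [set (g x.1, g x.2) | g : {perm T} in G] | x : T * T].

End CC.

(* Main.v *)
Require Import Defs.
From mathcomp Require Import all_boot all_fingroup.
From mathcomp Require Import cyclic zify.
Set Implicit Arguments. Unset Strict Implicit. Unset Printing Implicit Defensive.

(** We show more generally that every coherent configuration in which no non-diagonal basic
relation is symmetric has a generalized base consisting of one set [D], by induction on the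
set [L] of points to be resolved; in [Inv G] with [G] of odd order no such relation is
symmetric. To make the induction work, [D] is also required to contain no nonempty union
of fibers.

If [L] is not a fiber it is split. If [L] is a fiber, let [t] be a basic relation on [L] of
minimal valency [k > 0].

If [t] is not connected, its components are blocks of odd size [q]. The quotient is again
antisymmetric, by counting the arcs of an invariant tournament between two blocks modulo 2.
Resolve the quotient and all blocks by induction; since [q] is odd, each block can be given
either the minority or the majority half of its resolving set, which encodes the
resolving set of the quotient.

If [t] is connected, fix [a]. The key fact ([reach_avoid]) is that every point that is not
an out-neighbour of [a] reaches [a] by a [t]-path that avoids the out-neighbours of [a]; a
failure would give, by a counting argument based on the minimality of [k], two disjoint
subsets of [L] each of more than half its size. Now put the out-neighbours of [a] in [D], and
resolve the other points level by level, according to their distance to [a], from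
the farthest level on. Then [a] is recognized as the only point outside [D] with all its
out-neighbours in [D]; hence the levels are definable and all points except the out-neighbours
of [a] are resolved. Two of these [k] out-neighbours are separated as well: for
their colour [s] the symmetric difference of their [s]-neighbourhoods has more than [k] points,
hence contains a resolved one. *)

(** * Coherent families, colours and definable sets *)

Section Family.
Variable T : finType.
Implicit Types (F G B : {set {set T * T}}) (r s : {set T * T}) (A L : {set T}).
Implicit Types (p q : T * T) (x y z : T).

(* A coherent family is the set of all relations of a coherent configuration. *)
Definition coherent F : bool :=
  [&& diagT T \in F,
      [forall r in F, ~: r \in F],
      [forall r in F, forall s in F, r :&: s \in F],
      [forall r in F, transp r \in F] &
      [forall r in F, forall s in F, forall p : T * T,
         [set q | cnum r s q.1 q.2 == cnum r s p.1 p.2] \in F]].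

(** When [F] consists of the relations of a configuration, this means lying in the same basic
    relation, and [color F p] is the basic relation containing [p]. *)
Definition same_color F p q : bool := [forall r in F, (p \in r) == (q \in r)].

Definition color F p : {set T * T} := [set q | same_color F p q].

(** For coherent [F] these are the unions of fibers. *)
Definition definable F A : bool := diag_of A \in F.

Definition coherent_closure B : {set {set T * T}} :=
  \bigcap_(F : {set {set T * T}} | coherent F && (B \subset F)) F.

Definition nb r x : {set T} := [set y | (x, y) \in r].

Lemma in_diag A p : (p \in diag_of A) = (p.1 == p.2) && (p.1 \in A).
Proof.
apply/imsetP/andP=> [[x Ax ->]|[/eqP e Ax]] //=.
by exists p.1 => //; case: p e Ax => a b /= <-.
Qed.

Lemma in_transp r x y : ((x, y) \in transp r) = ((y, x) \in r).
Proof. by rewrite inE. Qed.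

Lemma transpK r : transp (transp r) = r.
Proof. by apply/setP=> -[x y]; rewrite !inE. Qed.

Lemma in_nb r x y : (y \in nb r x) = ((x, y) \in r).
Proof. by rewrite inE. Qed.

Lemma cnumE r s x y : cnum r s x y = #|nb r x :&: nb (transp s) y|.
Proof. by apply: eq_card => z; rewrite !inE. Qed.

Section Coherent.
Variable F : {set {set T * T}}.
Hypothesis cF : coherent F.

Lemma coh_diag : diagT T \in F.
Proof. by case/and5P: cF. Qed.

Lemma coh_setC r : r \in F -> ~: r \in F.
Proof. by case/and5P: cF => _ /forall_inP h _ _ _; apply: h. Qed.

Lemma coh_setI r s : r \in F -> s \in F -> r :&: s \in F.
Proof. by case/and5P: cF => _ _ /forall_inP h _ _ hr; move/(_ _ hr)/forall_inP: h; apply. Qed.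

Lemma coh_transp r : r \in F -> transp r \in F.
Proof. by case/and5P: cF => _ _ _ /forall_inP h _; apply: h. Qed.

Lemma coh_count r s p : r \in F -> s \in F ->
  [set q | cnum r s q.1 q.2 == cnum r s p.1 p.2] \in F.
Proof.
case/and5P: cF => _ _ _ _ /forall_inP h hr hs.
by move/(_ _ hr)/forall_inP/(_ _ hs)/forallP: h; apply.
Qed.

Lemma coh_set0 : set0 \in F.
Proof. by rewrite -(setICr (diagT T)) coh_setI ?coh_setC ?coh_diag. Qed.

Lemma coh_setT : setT \in F.
Proof. by rewrite -setC0 coh_setC ?coh_set0. Qed.

Lemma coh_setU r s : r \in F -> s \in F -> r :|: s \in F.
Proof. by move=> hr hs; rewrite -[r :|: s]setCK setCU coh_setC ?coh_setI ?coh_setC. Qed.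

Lemma coh_setD r s : r \in F -> s \in F -> r :\: s \in F.
Proof. by move=> hr hs; rewrite setDE coh_setI ?coh_setC. Qed.

Lemma same_color_refl p : same_color F p p.
Proof. by apply/forall_inP=> r _. Qed.

Lemma same_color_sym p q : same_color F p q = same_color F q p.
Proof. by apply: eq_forallb_in => r _; rewrite eq_sym. Qed.

Lemma same_color_in p q r : same_color F p q -> r \in F -> (p \in r) = (q \in r).
Proof. by move/forall_inP=> h /h/eqP. Qed.

Lemma same_color_trans p q p' :
  same_color F p q -> same_color F q p' -> same_color F p p'.
Proof.
move=> h1 h2; apply/forall_inP=> r hr.
by rewrite (same_color_in h1 hr) (same_color_in h2 hr).
Qed.

(** The colour is the intersection of the relations containing [p]; a relation missing [p] takes
    part through its complement. *)
Lemma color_in p : color F p \in F.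
Proof.
suff -> : color F p = \bigcap_(r in F | p \in r) r.
  apply: (big_ind (fun r => r \in F)) => [|r s|r /andP[]//].
    exact: coh_setT.
  exact: coh_setI.
apply/setP=> q; rewrite inE; apply/idP/bigcapP=> [h r /andP[hr pr]|h].
  by rewrite -(same_color_in h hr).
apply/forall_inP=> r hr; case pr: (p \in r); first by rewrite h ?hr.
have: q \in ~: r by apply: h; rewrite coh_setC // inE pr.
by rewrite inE => /negbTE->.
Qed.

(** Such an [r] is the union of the colours of its elements. This is the main way of showing that a
    formula defines a relation of [F]. *)
Lemma coh_invariant r :
  (forall p q, same_color F p q -> p \in r -> q \in r) -> r \in F.
Proof.
move=> h; suff -> : r = \bigcup_(p in r) color F p.
  apply: (big_ind (fun r => r \in F)) => [|r' s|p _].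
  - exact: coh_set0.
  - exact: coh_setU.
  - exact: color_in.
apply/setP=> q; apply/idP/bigcupP=> [hq|[p pr]].
  by exists q => //; rewrite inE same_color_refl.
by rewrite inE => /h; apply.
Qed.

Lemma same_color_cnum p q r s : same_color F p q -> r \in F -> s \in F ->
  cnum r s p.1 p.2 = cnum r s q.1 q.2.
Proof.
move=> h hr hs; have := same_color_in h (coh_count p hr hs).
by rewrite !inE eqxx => /esym/eqP->.
Qed.

Lemma same_color_swap p q : same_color F p q ->
  same_color F (p.2, p.1) (q.2, q.1).
Proof.
move=> h; apply/forall_inP=> r hr.
by have := same_color_in h (coh_transp hr); rewrite !inE => ->.
Qed.

Lemma same_color_diag p q : same_color F p q -> (p.1 == p.2) = (q.1 == q.2).
Proof. by move=> h; have := same_color_in h coh_diag; rewrite !inE. Qed.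

(** The loop at the start of a pair is coded by an intersection number: [cnum (r :&: diagT T) setT]
    is 1 or 0 according to whether the loop lies in [r]. *)
Lemma same_color_fst p q : same_color F p q ->
  same_color F (p.1, p.1) (q.1, q.1).
Proof.
move=> h; apply/forall_inP=> r hr.
have E u : cnum (r :&: diagT T) setT u.1 u.2 = ((u.1, u.1) \in r).
  rewrite cnumE; case ur: ((u.1, u.1) \in r).
    rewrite (_ : _ :&: _ = [set u.1]) ?cards1 //.
    apply/setP=> z; rewrite !inE /= andbT eq_sym.
    by case: eqP => [->|]; rewrite ?ur ?andbF.
  apply: eq_card0 => z; rewrite !inE /= andbT.
  by apply/negP=> /andP[h1 /eqP e]; rewrite -e ur in h1.
have := same_color_cnum h (coh_setI hr coh_diag) coh_setT.
by rewrite !E => /eqP; case: (_ \in r); case: (_ \in r).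
Qed.

Lemma definableP A :
  reflect (forall p q, same_color F p q -> (p.1 \in A) = (q.1 \in A))
          (definable F A).
Proof.
apply: (iffP idP) => [h p q /same_color_fst e|h].
  by have := same_color_in e h; rewrite !in_diag !eqxx.
apply: coh_invariant => p q e; rewrite !in_diag => /andP[pp pA].
by rewrite -(same_color_diag e) pp -(h _ _ e).
Qed.

Lemma definable_fst A p q : definable F A -> same_color F p q ->
  (p.1 \in A) = (q.1 \in A).
Proof. by move/definableP; apply. Qed.

Lemma definable_snd A p q : definable F A -> same_color F p q ->
  (p.2 \in A) = (q.2 \in A).
Proof. by move=> h /same_color_swap/(definable_fst h). Qed.

Lemma definableI A A' : definable F A -> definable F A' -> definable F (A :&: A').
Proof.
by move=> h h'; apply/definableP=> p q e; rewrite !inE (definable_fst h e) (definable_fst h' e).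
Qed.

Lemma definableC A : definable F A -> definable F (~: A).
Proof. by move=> h; apply/definableP=> p q e; rewrite !inE (definable_fst h e). Qed.

Lemma definableD A A' : definable F A -> definable F A' -> definable F (A :\: A').
Proof. by move=> h h'; rewrite setDE definableI ?definableC. Qed.

Lemma definableT : definable F setT.
Proof. by apply/definableP=> p q _; rewrite !inE. Qed.

Lemma coh_setX A A' : definable F A -> definable F A' -> setX A A' \in F.
Proof.
move=> h h'; apply: coh_invariant => p q e; rewrite !inE.
by rewrite (definable_fst h e) (definable_snd h' e).
Qed.

Lemma same_color_ex p q r s : same_color F p q -> r \in F -> s \in F ->
  [exists z, ((p.1, z) \in r) && ((z, p.2) \in s)] =
  [exists z, ((q.1, z) \in r) && ((z, q.2) \in s)].
Proof.
move=> e hr hs; have := same_color_cnum e hr hs.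
have E u : [exists z, ((u.1, z) \in r) && ((z, u.2) \in s)] = (0 < cnum r s u.1 u.2).
  rewrite card_gt0; apply/existsP/set0Pn => [] [z hz]; exists z; move: hz; rewrite inE //.
by rewrite !E => ->.
Qed.

Lemma card_nb_cnum r x : #|nb r x| = cnum r setT x x.
Proof. by rewrite cnumE; apply: eq_card => z; rewrite !inE andbT. Qed.

Lemma same_color_nb p q r : same_color F p q -> r \in F ->
  #|nb r p.1| = #|nb r q.1|.
Proof.
move=> /same_color_fst e hr; rewrite !card_nb_cnum.
exact: (same_color_cnum e hr coh_setT).
Qed.

Lemma definable_nb r x : r \in F -> definable F [set x] -> definable F (nb r x).
Proof.
move=> hr hx; apply/definableP=> p q e.
have E u : (u.1 \in nb r x) =
    [exists z, ((u.1, z) \in transp r) && ((z, u.2) \in setX [set x] setT)].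
  rewrite inE; apply/idP/existsP=> [h|[z]]; first by exists x; rewrite !inE /= h eqxx.
  by rewrite !inE /= => /andP[h /andP[/eqP<-]].
by rewrite !E; apply: same_color_ex e _ _; rewrite ?coh_transp ?coh_setX ?definableT.
Qed.

(** Two pairs of the same colour, one starting at [x] and the other at another point of [A], would
    be told apart by [C]. *)
Lemma definable_separated A : definable F A ->
  (forall x y, x \in A -> y \in A -> x != y ->
     exists2 C, definable F C & (x \in C) != (y \in C)) ->
  forall x, x \in A -> definable F [set x].
Proof.
move=> hA sep x xA; apply/definableP=> p q e; rewrite !inE.
have main u v : same_color F u v -> u.1 = x -> v.1 = x.
  move=> h ux; apply/eqP/contraT => vx.
  have vA : v.1 \in A by rewrite -(definable_fst hA h) ux.
  have [C hC] := sep _ _ vA xA vx.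
  by rewrite -(definable_fst hC h) ux eqxx.
by apply/eqP/eqP; apply: main; rewrite // same_color_sym.
Qed.

End Coherent.

Lemma same_color_sub F G p q : F \subset G -> same_color G p q -> same_color F p q.
Proof. by move=> /subsetP s /forall_inP h; apply/forall_inP=> r /s/h. Qed.

Lemma definable_sub F G A : F \subset G -> definable F A -> definable G A.
Proof. by move/subsetP; apply. Qed.

Lemma coherent_closureP B : coherent (coherent_closure B).
Proof.
have In r : reflect (forall F, coherent F -> B \subset F -> r \in F) (r \in coherent_closure B).
  apply: (iffP bigcapP) => h F; first by move=> cF BF; apply: h; rewrite cF.
  by case/andP; apply: h.
apply/and5P; split.
- by apply/In=> F cF _; apply: coh_diag.
- by apply/forall_inP=> r /In h; apply/In=> F cF BF; apply: coh_setC => //; apply: h.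
- apply/forall_inP=> r /In h; apply/forall_inP=> s /In h'; apply/In=> F cF BF.
  by apply: coh_setI => //; [apply: h | apply: h'].
- by apply/forall_inP=> r /In h; apply/In=> F cF BF; apply: coh_transp => //; apply: h.
- apply/forall_inP=> r /In h; apply/forall_inP=> s /In h'; apply/forallP=> p.
  by apply/In=> F cF BF; apply: coh_count => //; [apply: h | apply: h'].
Qed.

Lemma sub_coherent_closure B : B \subset coherent_closure B.
Proof. by apply/bigcapsP=> F /andP[]. Qed.

Lemma coherent_closure_sub B F : coherent F -> B \subset F -> coherent_closure B \subset F.
Proof. by move=> cF BF; apply: (bigcap_inf F); rewrite cF. Qed.

Definition individualize F A : {set {set T * T}} :=
  coherent_closure (F :|: [set diag_of [set x] | x in A]).

Lemma individualize_sup F A : F \subset individualize F A.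
Proof. exact: subset_trans (subsetUl _ _) (sub_coherent_closure _). Qed.

Lemma individualize_def F A x : x \in A -> definable (individualize F A) [set x].
Proof.
move=> xA; apply: (subsetP (sub_coherent_closure _)).
by rewrite inE; apply/orP; right; apply/imsetP; exists x.
Qed.

Lemma individualize_sub F A G : coherent G -> F \subset G ->
  (forall x, x \in A -> definable G [set x]) -> individualize F A \subset G.
Proof.
move=> cG FG h; apply: coherent_closure_sub => //; rewrite subUset FG.
by apply/subsetP=> _ /imsetP[x /h hx ->].
Qed.

Definition antisymmetric_on F L : Prop :=
  forall x y, x \in L -> y \in L -> same_color F (x, y) (y, x) -> x = y.

Lemma antisymmetric_sub F G A L : F \subset G -> A \subset L ->
  antisymmetric_on F L -> antisymmetric_on G A.
Proof.
move=> FG /subsetP AL h x y /AL xL /AL yL /(same_color_sub FG); exact: h.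
Qed.

Lemma sum_card_nb r A C :
  \sum_(x in A) #|nb r x :&: C| = \sum_(x in A) \sum_(y in C) ((x, y) \in r).
Proof.
apply: eq_bigr => x _; rewrite -sum1_card.
rewrite [RHS](bigID (fun y => (x, y) \in r)) /= [X in _ + X]big1 ?addn0.
  rewrite [RHS](eq_bigr (fun=> 1)) => [|y /andP[_ ->]] //.
  by apply: eq_bigl => y; rewrite !inE andbC.
by move=> y /andP[_ /negbTE->].
Qed.

Lemma card_edges r A C :
  \sum_(x in A) #|nb r x :&: C| = \sum_(y in C) #|nb (transp r) y :&: A|.
Proof.
rewrite !sum_card_nb exchange_big /=; apply: eq_bigr => y _; apply: eq_bigr => x _.
by rewrite in_transp.
Qed.

End Family.

(** In fractions: [u / nv <= v / nw] by the edge count between two colour classes, so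
    [1 - a / nw <= (1 - u / nv) + j / nw]. Multiplied by [k <= nw], the right side is at most
    [Ji + j <= Jb]. *)
Lemma escape_arith k nw nv a j u v Jb Ji c d : 0 < c -> 0 < nv -> nv * d = nw * c ->
  u * d <= v * c -> v <= a + j -> j + Ji <= Jb -> u <= nv -> a <= nw -> k <= nw ->
  k * (nv - u) <= nv * Ji -> k * (nw - a) <= nw * Jb.
Proof.
move=> c0 nv0 dc uv vaj jJ unv anw knw IH.
have := subnKC unv; move: (nv - u) IH => z IH nvE; rewrite -nvE in nv0 dc IH.
have := subnKC anw; move: (nw - a) => b nwE.
have key : nw * u <= (u + z) * v.
  rewrite -(leq_pmul2r c0) -mulnA [u * c]mulnC mulnA -dc -!mulnA leq_mul2l.
  by rewrite [d * u]mulnC uv orbT.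
have h1 : (u + z) * b <= nw * z + (u + z) * j.
  have : nw * u <= (u + z) * (a + j) by apply: leq_trans key _; rewrite leq_mul2l vaj orbT.
  rewrite -nwE; lia.
have h2 : k * ((u + z) * b) <= nw * (k * z) + (u + z) * (k * j).
  by have := leq_mul (leqnn k) h1; lia.
have h3 : nw * (k * z) <= nw * ((u + z) * Ji) by rewrite leq_mul2l IH orbT.
have h4 : (u + z) * (k * j) <= (u + z) * (nw * j) by rewrite leq_mul2l leq_mul2r knw !orbT.
have h5 : (u + z) * (nw * (j + Ji)) <= (u + z) * (nw * Jb) by rewrite !leq_mul2l jJ !orbT.
rewrite -(leq_pmul2l nv0); lia.
Qed.

Lemma cut_arith k l a j m : 0 < l -> m = l - a -> a <= l -> k * m <= l * j ->
  2 * j < k -> l < 2 * a.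
Proof.
move=> l0 -> al h jk; rewrite ltnNge; apply/negP=> h'.
have h1 : l * (2 * j) < l * k by rewrite ltn_pmul2l.
have h2 : k * l <= k * (2 * (l - a)) by rewrite leq_mul2l; apply/orP; right; lia.
lia.
Qed.

(** The second condition ensures that a nonempty definable set, such as a set of neighbours, is
    never swallowed by [D]. The third ranges over all coherent extensions, so that further sets may
    be fixed independently. *)
Definition resolving (T : finType) (F : {set {set T * T}}) (L D : {set T}) : Prop :=
  [/\ D \subset L,
      forall A : {set T}, definable F A -> A \subset D -> A = set0 &
      forall G : {set {set T * T}}, coherent G -> F \subset G -> definable G D ->
        forall x, x \in L -> definable G [set x]].

(** * Regularity inside a single fiber *)

Section Homogeneous.
Variables (T : finType) (F : {set {set T * T}}) (L : {set T}).
Implicit Types (r s c : {set T * T}) (A J : {set T}) (p q : T * T) (x y z : T).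
Hypothesis cF : coherent F.
Hypothesis dL : definable F L.
Hypothesis hom : forall A, definable F A -> A \subset L -> A = set0 \/ A = L.
Hypothesis anti : antisymmetric_on F L.

(** The points of [L] whose loop has the colour of the loop at [x] form a definable set, hence all
    of [L]. *)
Lemma hom_color x y : x \in L -> y \in L -> same_color F (x, x) (y, y).
Proof.
move=> xL yL; pose A := [set z in L | same_color F (x, x) (z, z)].
have dA : definable F A.
  apply/(definableP cF) => p q e; rewrite !inE (definable_fst cF dL e); congr (_ && _).
  have e1 := same_color_fst cF e.
  apply/idP/idP => h; apply: (same_color_trans h) => //.
  by rewrite same_color_sym.
have AL : A \subset L by apply/subsetP=> z; rewrite inE => /andP[].
have xA : x \in A by rewrite inE xL same_color_refl.
case: (hom dA AL) => E; first by rewrite E inE in xA.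
by have: y \in A by [rewrite E]; rewrite inE yL.
Qed.

Lemma hom_nb r x y : r \in F -> x \in L -> y \in L -> #|nb r x| = #|nb r y|.
Proof. by move=> hr xL yL; apply: (same_color_nb cF (hom_color xL yL) hr). Qed.

Lemma nb_sub r x : r \subset setX L L -> nb r x \subset L.
Proof. by move/subsetP=> h; apply/subsetP=> y; rewrite inE => /h; rewrite inE => /andP[]. Qed.

Lemma transp_sub r : r \subset setX L L -> transp r \subset setX L L.
Proof.
move/subsetP=> h; apply/subsetP=> -[x y]; rewrite inE => /h.
by rewrite !inE /= andbC.
Qed.

(** Count the edges of [r] inside [L] by their starts and by their ends. *)
Lemma nb_transp r x : r \in F -> r \subset setX L L -> x \in L ->
  #|nb (transp r) x| = #|nb r x|.
Proof.
move=> hr rL xL; have := card_edges r L L.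
rewrite (eq_bigr (fun=> #|nb r x|)) => [|y yL]; last first.
  by rewrite (setIidPl (nb_sub y rL)) (hom_nb hr yL xL).
rewrite [RHS](eq_bigr (fun=> #|nb (transp r) x|)) => [|y yL]; last first.
  by rewrite (setIidPl (nb_sub y (transp_sub rL))) (hom_nb (coh_transp cF hr) yL xL).
rewrite !sum_nat_const => /eqP; rewrite eqn_pmul2l; first by move/eqP.
by apply/card_gt0P; exists x.
Qed.

Lemma color_sub x y : x \in L -> y \in L -> color F (x, y) \subset setX L L.
Proof.
move=> xL yL; apply/subsetP=> q; rewrite inE => e.
by rewrite -(same_color_in e (coh_setX cF dL dL)) inE xL yL.
Qed.

Lemma mem_color p : p \in color F p.
Proof. by rewrite inE same_color_refl. Qed.

Lemma color_anti x y a b : x \in L -> y \in L -> x != y ->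
  (a, b) \in color F (x, y) -> (b, a) \notin color F (x, y).
Proof.
move=> xL yL xy ab; apply/negP=> ba.
have /subsetP/(_ _ ab) := color_sub xL yL; rewrite inE /= => /andP[aL bL].
have E : a = b.
  apply: (anti aL bL); rewrite !inE in ab ba.
  by apply: same_color_trans ba => //; rewrite same_color_sym.
rewrite inE in ab; have := same_color_diag cF ab.
by rewrite /= E eqxx (negbTE xy).
Qed.

(* The colour [s] induces on [nb s a] a digraph that is regular of degree
   [#|nb s a :&: nb s b|] and antisymmetric, so this degree is less than half of [#|nb s a|]. *)
Lemma card_sym_diff a b s : a \in L -> b \in L -> a != b -> s = color F (a, b) ->
  #|nb s a| < #|(nb s a :\: nb s b) :|: (nb s b :\: nb s a)|.
Proof.
move=> aL bL ab sE; have sF : s \in F by rewrite sE color_in.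
set m := #|nb s a|; set c := #|nb s a :&: nb s b|.
have m0 : 0 < m by apply/card_gt0P; exists b; rewrite in_nb sE mem_color.
have mb : #|nb s b| = m by apply: hom_nb.
have main : 2 * c < m.
  (* The arcs inside [nb s a], their reverses and the loops are disjoint, so
     [2 * m * c + m <= m * m]. *)
  pose X := [set p in setX (nb s a) (nb s a) | p \in s].
  have X1 : #|X| = m * c.
    have -> : #|X| = \sum_(x in nb s a) #|nb s x :&: nb s a|.
      rewrite -sum1_card (partition_big (fun p => p.1) (mem (nb s a))) /=; last first.
        by move=> p; rewrite !inE => /andP[/andP[]].
      apply: eq_bigr => x xa; rewrite -sum1_card.
      rewrite (reindex (fun y => (x, y))) /=; last first.
        by exists snd => [//|[u v]]; rewrite !inE /= => /andP[_ /eqP->].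
      apply: eq_bigl => y; rewrite !inE /= eqxx andbT; rewrite in_nb in xa.
      by rewrite xa andbC.
    rewrite -[LHS]/(\sum_(x in nb s a) _).
    rewrite (eq_bigr (fun=> c)) ?sum_nat_const // => x; rewrite in_nb => xa.
    rewrite sE inE in xa.
    have := same_color_cnum cF xa sF (coh_transp cF sF).
    by rewrite !cnumE /= transpK => e; rewrite setIC -e.
  pose Y := [set (p.2, p.1) | p in X].
  have cY : #|Y| = #|X|.
    by apply: card_imset => -[u v] [u' v'] /= [-> ->].
  pose W := [set (u, u) | u in nb s a].
  have cW : #|W| = m by apply: card_imset => u u' [].
  have sub : X :|: Y :|: W \subset setX (nb s a) (nb s a).
    rewrite !subUset; apply/andP; split; [apply/andP; split|].
    - by apply/subsetP=> p; rewrite inE => /andP[].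
    - by apply/subsetP=> q /imsetP[p]; rewrite !inE => /andP[/andP[h h'] _] ->; rewrite /= h h'.
    - by apply/subsetP=> q /imsetP[u ua ->]; rewrite inE /= ua.
  have irr p : p \in s -> p.1 != p.2.
    by rewrite sE inE => e; rewrite -(same_color_diag cF e).
  have d1 : [disjoint X & Y].
    apply/pred0P=> p /=; apply/negbTE/negP => /andP[]; rewrite inE => /andP[_ ps].
    case/imsetP=> -[u v]; rewrite inE => /andP[_ uv] /= E; rewrite E in ps.
    by rewrite sE in ps uv; have := color_anti aL bL ab uv; rewrite ps.
  have d2 : [disjoint X :|: Y & W].
    apply/pred0P=> p /=; apply/negbTE/negP => /andP[h /imsetP[u _ E]].
    rewrite E {E} in h; move: h; rewrite inE => /orP[|/imsetP[[v w]]].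
      by rewrite inE => /andP[_ /irr]; rewrite /= eqxx.
    by rewrite inE => /andP[_ /irr /= h] [e1 e2]; rewrite -e1 e2 eqxx in h.
  have := subset_leq_card sub; rewrite cardsX.
  rewrite !cardsU (eqP (_ : (X :|: Y) :&: W == set0)) ?setI_eq0 //.
  rewrite (eqP (_ : X :&: Y == set0)) ?setI_eq0 // cards0 !subn0 cY X1 cW -/m.
  by rewrite addnn -muln2 -mulnA -mulnSr leq_pmul2l // mulnC.
rewrite cardsU (eqP (_ : _ :&: _ == set0)) ?cards0; last first.
  by apply/eqP/setP=> z; rewrite !inE; case: (_ \in s); case: (_ \in s).
rewrite !cardsD mb [nb s b :&: _]setIC -/c -/m.
clear -main; lia.
Qed.

(** * Paths avoiding a given relation *)

Section Reach.
Variables s c : {set T * T}.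

(* [(x, y)] is in [reach] when an [s]-path in [L] leads from [x] to [y] and no later point
   of it is a [c]-neighbour of [x]; [ball i] bounds its length by [i.-1]. *)
Definition reach_step (X : {set T * T}) : {set T * T} :=
  diag_of L :|:
  [set p in setX L L | (p \notin c) && [exists z, ((p.1, z) \in X) && ((z, p.2) \in s)]].

Definition ball i := iter i reach_step set0.
Definition reach := fixset reach_step.

Lemma reach_step_mono : {homo reach_step : X Y / X \subset Y}.
Proof.
move=> X Y /subsetP XY; apply/setUS/subsetP=> p; rewrite !inE.
case/and3P=> -> -> /existsP[z /andP[h h']].
by apply/existsP; exists z; rewrite XY.
Qed.

Lemma ball_reach i : ball i \subset reach.
Proof. exact: (iter_sub_fix reach_step_mono). Qed.

Lemma ballS i : ball i \subset ball i.+1.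
Proof. by elim: i => [|i IH]; [apply: sub0set | apply: reach_step_mono]. Qed.

Lemma ballP i x y : reflect
  ((x = y /\ x \in L) \/ [/\ x \in L, y \in L, (x, y) \notin c &
     exists2 z, (x, z) \in ball i & (z, y) \in s]) ((x, y) \in ball i.+1).
Proof.
rewrite /= in_setU in_diag /= !inE /=; apply: (iffP orP).
  case=> [/andP[/eqP]|/and3P[/andP[h h'] h2 /existsP[z /andP[]]]]; first by left.
  by right; split => //; exists z.
case=> [[-> ->]|[-> -> -> [z h h']]]; first by rewrite eqxx; left.
by right; apply/existsP; exists z; rewrite h h'.
Qed.

Lemma reach_refl x : x \in L -> (x, x) \in reach.
Proof. by move=> xL; apply: (subsetP (ball_reach 1)); apply/ballP; left. Qed.

Lemma reach_next x z y : (x, z) \in reach -> (z, y) \in s -> x \in L -> y \in L ->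
  (x, y) \notin c -> (x, y) \in reach.
Proof.
move=> xz zy xL yL xy; rewrite /reach -(fixsetK reach_step_mono).
by apply/(@ballP #|{: T * T}|); right; split => //; exists z.
Qed.

Lemma reach_ind (P : T -> T -> Prop) :
  (forall x, x \in L -> P x x) ->
  (forall x z y, x \in L -> y \in L -> (x, y) \notin c -> (x, z) \in reach -> P x z ->
     (z, y) \in s -> P x y) ->
  forall x y, (x, y) \in reach -> P x y.
Proof.
move=> P0 PS; suff h i x y : (x, y) \in ball i -> P x y by move=> x y; apply: h.
elim: i x y => [|i IH] x y; first by rewrite inE.
case/ballP=> [[<- /P0//]|[xL yL xy [z xz zy]]].
by apply: PS zy => //; [apply: (subsetP (ball_reach i)) | apply: IH].
Qed.

Lemma reach_sub : reach \subset setX L L.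
Proof.
apply/subsetP=> -[x y] h; suff: x \in L /\ y \in L by rewrite inE /= => -[-> ->].
by move: x y h; apply: reach_ind.
Qed.

Hypotheses (sF : s \in F) (kF : c \in F).

Lemma ball_in i : ball i \in F.
Proof.
elim: i => [|i IH]; first exact: coh_set0.
rewrite /= coh_setU //; apply: coh_invariant => // p q e.
rewrite !inE (definable_fst cF dL e) (definable_snd cF dL e) (same_color_in e kF).
by rewrite (same_color_ex cF e IH sF).
Qed.

(** [fixset] is by definition a sufficiently long iterate, so [reach] is a ball. *)
Lemma reach_in : reach \in F.
Proof. exact: ball_in. Qed.

End Reach.

(** All edges starting in [A] stay in [A]; as in- and out-valencies agree, they already account for
    all edges ending in [A]. *)
Lemma closed_transp s A : s \in F -> s \subset setX L L -> A \subset L ->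
  (forall x y, x \in A -> (x, y) \in s -> y \in A) ->
  forall x y, y \in A -> (x, y) \in s -> x \in A.
Proof.
move=> sF sL /subsetP AL clA x y yA xy; have yL := AL _ yA.
have eq1 : \sum_(v in A) #|nb s v :&: A| = #|A| * #|nb s y|.
  rewrite (eq_bigr (fun=> #|nb s y|)) ?sum_nat_const // => v vA.
  rewrite (setIidPl _) ?(hom_nb sF (AL _ vA) yL) //.
  by apply/subsetP=> w; rewrite in_nb => /(clA _ _ vA).
have eq2 : \sum_(v in A) #|nb (transp s) v| = #|A| * #|nb s y|.
  rewrite (eq_bigr (fun=> #|nb s y|)) ?sum_nat_const // => v vA.
  by rewrite nb_transp ?AL //; apply: hom_nb => //; apply: AL.
rewrite card_edges -eq2 in eq1.
apply/contraT => xA; suff: \sum_(v in A) #|nb (transp s) v :&: A| <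
  \sum_(v in A) #|nb (transp s) v| by rewrite eq1 ltnn.
rewrite (bigD1 y) //= [X in _ < X](bigD1 y) //= -addSn leq_add //.
  apply: proper_card; apply/properP; split; first exact: subsetIl.
  by exists x; rewrite !inE ?xy //= xA.
by apply: leq_sum => v _; apply: subset_leq_card; apply: subsetIl.
Qed.

(** * Separating sets and minimal valency *)

Section MinValency.
Variable k : nat.
Hypothesis mink : forall x y, x \in L -> y \in L -> x != y ->
  k <= #|nb (color F (x, y)) x|.

Section Cut.
Variables (s : {set T * T}) (A J : {set T}) (x : T).
Hypotheses (sF : s \in F) (AL : A \subset L) (xA : x \in A).
Hypothesis bnd : forall v w, v \in A -> (v, w) \in s -> w \in A :|: J.

(* By induction on the distance from [x]: the [s]-edges between consecutive colour classes of
   [x] form a biregular graph, so the fraction of a class lying outside [A] grows at each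
   step at most by the fraction of the new class, of size at least [k], lying in [J]. *)
Lemma escape_bound i y : (x, y) \in ball s set0 i -> let w := color F (x, y) in
  is_true (k * #|nb w x :\: A| <= #|nb w x| * #|J :&: nb (ball s set0 i) x|).
Proof.
have xL : x \in L by apply: (subsetP AL).
elim: i y => [|i IH] y; first by rewrite inE.
move=> xy w; set b := ball _ _ _.
have w0 : (x, y) \in w by rewrite inE same_color_refl.
have wF : w \in F by apply: color_in.
have biF : ball s set0 i \in F by apply: ball_in; rewrite ?coh_set0.
have bS : ball s set0 i \subset b by apply: ballS.
case xyi: ((x, y) \in ball s set0 i).
  apply: leq_trans (IH _ xyi) _; rewrite leq_mul2l; apply/orP; right.
  apply: subset_leq_card; apply: setIS; apply/subsetP=> z; rewrite !in_nb.
  by apply: (subsetP bS).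
case/ballP: (xy) => [[exy _]|[_ yL _ [v xv vy]]].
  suff -> : nb w x :\: A = set0 by rewrite cards0 muln0.
  apply/setP=> z; rewrite !inE; apply/negbTE/negP => /andP[zA].
  by move/(same_color_diag cF); rewrite /= exy eqxx => /esym/eqP e; rewrite -e -exy xA in zA.
set w' := color F (x, v).
have w'F : w' \in F by apply: color_in.
have w'0 : (x, v) \in w' by rewrite inE same_color_refl.
have xney : x != y.
  apply/eqP=> e; move: xyi; rewrite -e => /negP; apply.
  case: (i) xv => [|j _]; first by rewrite inE.
  by apply/ballP; left.
have nwk : k <= #|nb w x| by apply: mink.
set nw := #|nb w x| in nwk *; set nv := #|nb w' x|.
have nv0 : 0 < nv by apply/card_gt0P; exists v; rewrite in_nb.
pose d := #|nb s v :&: nb w x|; pose c := #|nb (transp s) y :&: nb w' x|.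
have dE (p : T) : p \in nb w' x -> #|nb s p :&: nb w x| = d.
  rewrite in_nb inE => e.
  have := same_color_cnum cF e wF (coh_transp cF sF).
  by rewrite !cnumE /= transpK /d [nb s p :&: _]setIC => <-; rewrite setIC.
have cE (q : T) : q \in nb w x -> #|nb (transp s) q :&: nb w' x| = c.
  rewrite in_nb inE => e.
  have := same_color_cnum cF e w'F sF.
  by rewrite !cnumE /= /c [nb (transp s) q :&: _]setIC => <-; rewrite setIC.
have c0 : 0 < c.
  by apply/card_gt0P; exists v; rewrite !inE vy /= same_color_refl.
have dc : nv * d = nw * c.
  have := card_edges s (nb w' x) (nb w x).
  by rewrite (eq_bigr _ dE) [RHS](eq_bigr _ cE) !sum_nat_const.
(* Edges starting in [Z] end in [A :|: J], so those ending in the class [w] end in [Y]. *)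
set Z := nb w' x :&: A; set Y := nb w x :&: (A :|: J).
have ZY : #|Z| * d <= #|Y| * c.
  have := card_edges s Z (nb w x).
  rewrite (eq_bigr (fun=> d)) ?sum_nat_const => [|p /setIP[pw _]]; last exact: dE.
  move=> ->; rewrite (bigID (mem (A :|: J))) /= [X in _ + X]big1 ?addn0.
    rewrite (eq_bigl (fun q : T => q \in Y)); last by move=> q; rewrite /Y in_setI.
    rewrite -sum_nat_const; apply: leq_sum => q /setIP[/cE<- _].
    by apply: subset_leq_card; apply: setIS; apply: subsetIl.
  move=> q /andP[_ qAJ]; apply: eq_card0 => p; apply/negbTE/negP.
  rewrite in_setI => /andP[]; rewrite in_nb in_transp => pq /setIP[_ pA].
  by rewrite (bnd pA pq) in qAJ.
have Ysum : #|Y| <= #|nb w x :&: A| + #|nb w x :&: J|.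
  by rewrite /Y setIUr cardsU leq_subr.
(* Both balls are unions of colours, so the class [w] is disjoint from the smaller one and contained
   in the larger one. *)
have Jsum : #|nb w x :&: J| + #|J :&: nb (ball s set0 i) x| <= #|J :&: nb b x|.
  rewrite -cardsUI [X in _ + X](_ : _ = 0) ?addn0.
    apply: subset_leq_card; apply/subsetP=> z.
    rewrite in_setU !in_setI !in_nb => /orP[/andP[e ->]|/andP[->]] /=.
      by rewrite inE in e; rewrite -(same_color_in e (ball_in sF (coh_set0 cF) i.+1)).
    by apply: (subsetP bS).
  apply: eq_card0 => z; rewrite !in_setI !in_nb; apply/negbTE/negP => /andP[/andP[e _] /andP[_]].
  by rewrite inE in e; rewrite -(same_color_in e biF) xyi.
have := IH _ xv; rewrite -/w' -/nv /= !cardsD -/nv -/nw -/Z.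
have Zv : #|Z| <= nv by apply: subset_leq_card; apply: subsetIl.
have Aw : #|nb w x :&: A| <= nw by apply: subset_leq_card; apply: subsetIl.
exact: (escape_arith c0 nv0 dc ZY Ysum Jsum Zv Aw nwk).
Qed.

(** The colour classes of [x] partition [L]; summing [escape_bound] over them gives
    [k * #|L :\: A| <= #|L| * #|J|], where [J] has fewer than [k / 2] points. *)
Lemma cut_large : (forall y, y \in L -> (x, y) \in reach s set0) ->
  2 * #|J| < k -> #|L| < 2 * #|A|.
Proof.
move=> conn Jk; have xL : x \in L by apply: (subsetP AL).
pose f y := color F (x, y).
have fE y : y \in L -> [set z in L | f z == f y] = nb (f y) x.
  move=> yL; apply/setP=> z; rewrite in_nb inE.
  apply/andP/idP => [[_ /eqP <-]|h]; first by rewrite inE same_color_refl.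
  have zL : z \in L by apply: (subsetP (nb_sub x (color_sub xL yL))); rewrite in_nb.
  split=> //; rewrite inE in h; apply/eqP/setP=> q; rewrite !inE.
  apply/idP/idP => h'; apply: (same_color_trans _ h') => //.
  by rewrite same_color_sym.
have part (B : {set T}) : B \subset L -> #|B| = \sum_(w in f @: L) #|B :&: [set z in L | f z == w]|.
  move=> /subsetP BL; rewrite -sum1_card (partition_big f (mem (f @: L))) /=; last first.
    by move=> z /BL zL; apply: imset_f.
  apply: eq_bigr => w _; rewrite -sum1_card; apply: eq_bigl => z; rewrite !inE.
  by case zB: (z \in B) => //=; rewrite (BL _ zB).
have main : k * #|L :\: A| <= #|L| * #|J|.
  rewrite (part _ (subsetDl _ _)) big_distrr /=.
  rewrite [#|L| in X in _ <= X](part _ (subxx _)) big_distrl /=.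
  apply: leq_sum => _ /imsetP[y yL ->].
  rewrite fE // (setIidPr (nb_sub x (color_sub xL yL))).
  apply: leq_trans (leq_trans (escape_bound (conn _ yL)) _).
    rewrite leq_mul2l; apply/orP; right; apply: subset_leq_card.
    by rewrite setDE setIAC -setDE setSD // subsetIr.
  by rewrite leq_mul2l; apply/orP; right; apply: subset_leq_card; apply: subsetIl.
have L0 : 0 < #|L| by apply/card_gt0P; exists x.
have := cardsD L A; rewrite (setIidPr AL) => e.
exact: (cut_arith L0 e (subset_leq_card AL) main Jk).
Qed.

End Cut.

(** * Reaching a point while avoiding its out-neighbours *)

Section Connected.
Variable t : {set T * T}.
Hypotheses (tF : t \in F) (tL : t \subset setX L L).
Hypothesis tanti : forall x y, (x, y) \in t -> (y, x) \notin t.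
Hypothesis k0 : 0 < k.
Hypothesis tk : forall x, x \in L -> #|nb t x| = k.
Hypothesis conn : forall x y, x \in L -> y \in L -> (x, y) \in reach t set0.

(* [(a, b)] is in [V] when [b] reaches [a] by a [t]-path avoiding the out-neighbours of [a]. *)
Local Notation t' := (transp t).
Local Notation V := (reach t' t).
(** The pairs that would contradict [reach_avoid]. *)
Let U := setX L L :\: (t :|: V).

Lemma transp_in : t' \in F. Proof. exact: coh_transp. Qed.

Lemma edgeL x y : (x, y) \in t -> x \in L /\ y \in L.
Proof. by move/(subsetP tL); rewrite inE => /andP. Qed.

(** The set reached from [x] along [t'] is closed under [t'], hence by [closed_transp] also under
    [t], and [t] connects all of [L]. *)
Lemma conn_transp x y : x \in L -> y \in L -> (x, y) \in reach t' set0.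
Proof.
move=> xL yL; set A := nb (reach t' set0) x.
have AL : A \subset L by apply: nb_sub; apply: reach_sub.
have A' u v : u \in A -> (u, v) \in t' -> v \in A.
  rewrite !in_nb => xu uv; apply: (reach_next xu uv) => //; last by rewrite inE.
  by rewrite in_transp in uv; case/edgeL: uv.
have At u v : u \in A -> (u, v) \in t -> v \in A.
  move=> uA uv; apply: (closed_transp transp_in (transp_sub tL) AL A' uA).
  by rewrite in_transp.
suff h a b : (a, b) \in reach t set0 -> a \in A -> b \in A.
  by rewrite -in_nb; apply: (h x y); [apply: conn | rewrite in_nb reach_refl].
by move: a b; apply: reach_ind => // a c b _ _ _ _ IH cb /IH/At; apply.
Qed.

Lemma UE a b : (a, b) \in U = [&& a \in L, b \in L, (a, b) \notin t & (a, b) \notin V].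
Proof. by rewrite !inE /= negb_or; case: (a \in L); case: (b \in L); rewrite ?andbF ?andbT. Qed.

Lemma U_in : U \in F.
Proof. by rewrite coh_setD ?coh_setX ?coh_setU ?reach_in ?transp_in. Qed.

Lemma V_in : V \in F.
Proof. by rewrite reach_in ?transp_in. Qed.

Lemma V_not_t a b : (a, b) \in V -> (a, b) \notin t.
Proof.
move: a b; apply: reach_ind => // x xL; apply/negP=> h.
by have := tanti h; rewrite h.
Qed.

Lemma V_back a b z : a \in L -> (b, z) \in t -> (a, z) \in V -> (a, b) \notin t -> (a, b) \in V.
Proof.
move=> aL bz az ab; apply: (reach_next az) => //; first by rewrite in_transp.
by case/edgeL: bz.
Qed.

Lemma t_transp_V a b : (b, a) \in t -> (a, b) \in V.
Proof.
move=> ba; have [bL aL] := edgeL ba.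
by apply: (V_back aL ba); [apply: reach_refl | apply: tanti].
Qed.

(** A path from [z] to [a] avoiding the out-neighbours of [a] could be prolonged backwards to
    [b]. *)
Lemma U_next a b z : (a, b) \in U -> (b, z) \in t -> (a, z) \notin V.
Proof.
rewrite UE => /and4P[aL bL ab abV] bz; apply: contra abV => azV.
exact: V_back bz azV ab.
Qed.

(* If [(b, a)] were in [V] then [nb V a] would be contained in [nb V b]; having the same
   size the two sets would be equal, although only the second one contains [b]. *)
Lemma U_sym a b : (a, b) \in U -> (b, a) \in U.
Proof.
move=> abU; have := abU; rewrite !UE => /and4P[aL bL ab abV]; rewrite aL bL /=.
apply/andP; split; first by apply: contra abV; apply: t_transp_V.
apply/negP=> baV; move/negP: abV; apply.
have sub v : v \in nb V a -> v \in nb V b.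
  rewrite !in_nb.
  suff h x y : (x, y) \in V -> x = a -> (b, y) \in V by move/h=> ->.
  move: x y; apply: reach_ind => [x _ ->//|x z y _ yL xy xz IH zy xa].
  have {}IH := IH xa; rewrite in_transp in zy.
  apply: (V_back bL zy IH); apply/negP=> byt.
  have := U_next abU byt; rewrite -xa (reach_next xz) ?in_transp //.
  by rewrite xa.
have /eqP E : nb V a == nb V b.
  rewrite eqEcard; apply/andP; split; first by apply/subsetP.
  by rewrite (hom_nb V_in aL bL).
by rewrite -in_nb E in_nb reach_refl.
Qed.

(* Count the [t]-edges from [nb U a] to [nb t a]: the colour of [(a, b)] and its transpose
   together contribute at least [2 k] sources, each with [#|nb t a :&: nb t b|] edges. *)
Lemma U_common a b : (a, b) \in U -> 2 * #|nb t a :&: nb t b| < k.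
Proof.
move=> abU; have := abU; rewrite UE => /and4P[aL bL ab abV].
have anb : a != b by apply: contraNneq abV => <-; apply: reach_refl.
set i := #|nb t a :&: nb t b|.
set u := color F (a, b); have uF : u \in F by apply: color_in.
have uU p : p \in u -> p \in U.
  by rewrite inE => e; rewrite -(same_color_in e U_in).
have uL : u \subset setX L L by apply: color_sub.
have ub : (a, b) \in u by rewrite inE same_color_refl.
have icst x y : (x, y) \in u -> #|nb t x :&: nb t y| = i.
  rewrite inE => e; have := same_color_cnum cF e tF transp_in.
  by rewrite !cnumE /= transpK => <-.
set W := nb u a :|: nb (transp u) a.
have cW : k * 2 <= #|W|.
  rewrite cardsU (eqP (_ : _ :&: _ == set0)) ?cards0 ?subn0; last first.
    apply/eqP/setP=> z; rewrite in_setI !in_nb in_transp in_set0.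
    by apply/negbTE/negP=> /andP[h]; apply/negP; apply: color_anti h.
  by rewrite nb_transp // muln2 -addnn leq_add ?mink.
have WU z : z \in W -> z \in nb U a /\ #|nb t z :&: nb t a| = i.
  rewrite in_setU !in_nb in_transp => /orP[h|h].
    by split; [apply: uU | rewrite setIC; apply: icst].
  by split; [apply: U_sym; apply: uU | apply: icst].
have low : #|W| * i <= \sum_(z in nb U a) #|nb t z :&: nb t a|.
  rewrite (big_setID W) /= -sum_nat_const; apply: leq_trans (leq_addr _ _).
  rewrite (setIidPr _); last by apply/subsetP=> z /WU[].
  by apply: leq_sum => z /WU[_ ->].
have up : \sum_(z in nb U a) #|nb t z :&: nb t a| <= k * k.-1.
  rewrite card_edges -(tk aL) -sum_nat_const; apply: leq_sum => z; rewrite in_nb => az.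
  have [_ zL] := edgeL az; rewrite -ltnS prednK; last first.
    by apply/card_gt0P; exists z; rewrite in_nb.
  rewrite (tk aL) -(tk zL) -(nb_transp tF tL zL).
  apply: proper_card; apply/properP; split; first exact: subsetIl.
  by exists a; rewrite ?in_setI !in_nb ?in_transp // az UE aL /= reach_refl ?andbF.
have := leq_trans (leq_trans (leq_mul cW (leqnn i)) low) up.
rewrite -mulnA leq_pmul2l // => h.
by apply: leq_ltn_trans h _; rewrite ltn_predL.
Qed.

(* Otherwise [J], of size less than [k / 2], separates the intersection from the complement
   of its union with [J], and by [cut_large] both sides contain more than half of [L]. *)
Lemma U_disjoint a b : (a, b) \in U -> nb V a :&: nb V b = set0.
Proof.
move=> abU; have baU := U_sym abU.
have := abU; rewrite UE => /and4P[aL bL ab abV].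
set J := nb t a :&: nb t b; set I := _ :&: _.
have IL : I \subset L by rewrite subIset // nb_sub ?reach_sub.
have inI v w : v \in I -> (w, v) \in t -> w \in I :|: J.
  rewrite in_setI !in_nb => /andP[av bv] wv.
  have ha : ((a, w) \in V) || ((a, w) \in t).
    by case at_: ((a, w) \in t); rewrite ?orbT // (V_back aL wv av) ?at_.
  have hb : ((b, w) \in V) || ((b, w) \in t).
    by case bt: ((b, w) \in t); rewrite ?orbT // (V_back bL wv bv) ?bt.
  rewrite in_setU !in_setI !in_nb.
  case/orP: ha => ha; case/orP: hb => hb; rewrite ha hb ?orbT //.
    by have := U_next abU hb; rewrite ha.
  by have := U_next baU ha; rewrite hb.
have Jk := U_common abU.
apply/eqP/negPn/negP => /set0Pn[v vI].
have vL := subsetP IL _ vI.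
have bndI u w : u \in I -> (u, w) \in t' -> w \in I :|: J.
  by move=> uI; rewrite in_transp; apply: inI.
have big1 : #|L| < 2 * #|I|.
  apply: (cut_large transp_in IL vI bndI _ Jk) => y yL.
  exact: conn_transp.
set Z := L :\: (I :|: J).
have aZ : a \in Z.
  rewrite in_setD aL andbT in_setU !in_setI !in_nb negb_or !negb_and.
  move: baU; rewrite UE => /and4P[_ _ _ ->]; rewrite orbT /=.
  by apply/orP; left; apply/negP=> h; have := tanti h; rewrite h.
have bndZ u w : u \in Z -> (u, w) \in t -> w \in Z :|: J.
  move=> uZ uw; have [_ wL] := edgeL uw; rewrite in_setU in_setD wL andbT in_setU.
  case wJ: (w \in J); rewrite ?orbT ?orbF //.
  by apply/negP=> wI; move: uZ; rewrite in_setD (inI _ _ wI uw).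
have big2 : #|L| < 2 * #|Z|.
  apply: (cut_large tF (subsetDl _ _) aZ bndZ _ Jk) => y yL; exact: conn.
have : #|I| + #|Z| <= #|L|.
  rewrite -cardsUI (_ : I :&: Z = set0) ?cards0 ?addn0.
    by rewrite subset_leq_card // subUset IL subsetDl.
  by apply/setP=> z; rewrite in_setI in_setD in_setU in_set0; case: (z \in I).
clear -big1 big2; lia.
Qed.

(** [nb U a] is closed under in-neighbours: by [U_next] and [U_disjoint] these lie neither in
    [nb t a] nor in [nb V a]. If it were nonempty, connectedness would put [a] itself into it. *)
Lemma reach_avoid a b : a \in L -> b \in L -> (a, b) \notin t -> (a, b) \in V.
Proof.
move=> aL bL ab; apply/contraT => abV.
have abU : (a, b) \in U by rewrite UE aL bL ab.
have clU x y : x \in nb U a -> (x, y) \in t' -> y \in nb U a.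
  rewrite !in_nb in_transp => axU yx.
  have xyV := t_transp_V yx; have [yL xL] := edgeL yx.
  rewrite UE aL yL /=; apply/andP; split.
    by apply/negP=> ay; have := U_next (U_sym axU) ay; rewrite xyV.
  apply/negP=> ayV; have : y \in nb V a :&: nb V x by rewrite in_setI !in_nb ayV.
  by rewrite (U_disjoint axU) in_set0.
suff h x y : (x, y) \in reach t' set0 -> x \in nb U a -> y \in nb U a.
  have: a \in nb U a by apply: (h b a); [apply: conn_transp | rewrite in_nb].
  by rewrite in_nb UE reach_refl // !andbF.
by move: x y; apply: reach_ind => // x z y _ _ _ _ IH zy /IH/clU; apply.
Qed.

(** * Resolving a connected fiber level by level *)

Section Leader.
Variable a : T.
Hypothesis aL : a \in L.
Hypothesis IH : forall (G : {set {set T * T}}) A, coherent G -> definable G A ->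
  antisymmetric_on G A -> #|A| < #|L| -> exists D, resolving G A D.

(** [near j] holds the points with a path of fewer than [j] edges to [a] avoiding the out-neighbours
    of [a], so [near 1] is just [a]; [far j] holds the points at distance at least [j]. *)
Let near j := nb (ball t' t j) a.
Let far j := nb V a :\: near j.

Lemma near_sub j : near j \subset nb V a.
Proof.
apply/subsetP=> z; rewrite !in_nb => h.
exact: (subsetP (ball_reach t' t j)).
Qed.

Lemma nearS j : near j \subset near j.+1.
Proof. by apply/subsetP=> z; rewrite !in_nb; apply: (subsetP (ballS t' t j)). Qed.

Lemma a_near j : a \in near j.+1.
Proof. by rewrite in_nb; apply/ballP; left. Qed.

Lemma near_definable G j : coherent G -> F \subset G -> definable G [set a] ->
  definable G (near j).
Proof.
move=> cG FG da; apply: definable_nb => //; apply: (subsetP FG).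
by apply: ball_in; rewrite ?transp_in.
Qed.

Lemma far_definable G j : coherent G -> F \subset G -> definable G [set a] ->
  definable G (far j).
Proof.
move=> cG FG da; apply: definableD => //; last exact: near_definable.
by apply: definable_nb => //; apply: (subsetP FG); apply: V_in.
Qed.

(* Levels are treated from the farthest to the nearest: when a level [M] is resolved, the
   points [b] of the next farther level are already definable, so [nb t b :&: M] is a nonempty
   definable set and cannot be contained in the part of [D] chosen inside [M]. *)
Lemma resolve_levels m j : 0 < j -> #|{: T * T}| <= j + m ->
  exists D : {set T}, [/\ D \subset far j,
    forall G : {set {set T * T}}, coherent G -> F \subset G -> definable G [set a] ->
      definable G D -> forall x, x \in far j -> definable G [set x] &
    forall b, b \in far j.+1 -> exists2 z, z \in far j :\: D & (b, z) \in t].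
Proof.
elim: m j => [|m IHm] j j0 jm.
  (* The balls are stable after as many steps as there are pairs. *)
  have far0 i : j <= i -> far i = set0.
    move=> ji; apply/eqP; rewrite setD_eq0; apply/subsetP=> z; rewrite !in_nb.
    have: ball t' t #|{: T * T}| \subset ball t' t i.
      rewrite addn0 in jm; rewrite -(subnKC (leq_trans jm ji)).
      elim: (i - _) => [|l IHl]; first by rewrite addn0.
      by rewrite addnS; apply: subset_trans IHl (ballS _ _ _).
    by move/subsetP; apply.
  exists set0; split; rewrite ?sub0set //.
    by move=> G _ _ _ _ x; rewrite far0 // inE.
  by move=> b; rewrite far0 ?inE.
have [|D [Dsub Dres Dnext]] := IHm j.+1 isT; first by rewrite addSnnS.
set M := near j.+1 :\: near j.
have farE : far j = far j.+1 :|: M.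
  apply/setP=> z; rewrite in_setU !in_setD.
  have := subsetP (nearS j) z; have := subsetP (near_sub j.+1) z.
  by case: (z \in near j); case: (z \in near j.+1); case: (z \in nb V a) => //= h1 h2;
    rewrite ?(h1 isT) ?(h2 isT) //; have := h2 isT; have := h1 isT.
(* The level [M] is resolved over the family in which [a] and all farther points are already
   fixed. *)
set G1 := individualize F (a |: far j.+1).
have cG1 : coherent G1 by apply: coherent_closureP.
have FG1 : F \subset G1 by apply: individualize_sup.
have da1 : definable G1 [set a] by apply: individualize_def; rewrite setU11.
have dM : definable G1 M by apply: definableD => //; apply: near_definable.
have VL : nb V a \subset L by rewrite nb_sub ?reach_sub.
have ML : M \subset L by apply: subset_trans (subsetDl _ _) (subset_trans (near_sub _) VL).
have Mlt : #|M| < #|L|.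
  apply: proper_card; apply/properP; split => //; exists a => //.
  by rewrite in_setD; case: (j) j0 => // i _; rewrite a_near.
have [DM [DMsub DMfree DMres]] := IH cG1 dM (antisymmetric_sub FG1 ML anti) Mlt.
have disj z : z \in far j.+1 -> z \notin M.
  by rewrite !in_setD => /andP[/negbTE->]; rewrite andbF.
exists (D :|: DM); split.
- by rewrite farE setUSS.
- move=> G cG FG da dD.
  have dD0 : definable G D.
    have -> : D = (D :|: DM) :&: far j.+1.
      apply/setP=> z; rewrite in_setI in_setU.
      case zD: (z \in D); first by rewrite (subsetP Dsub).
      by case zM: (z \in DM) => //=; apply/esym/negbTE/negP => /disj; rewrite (subsetP DMsub).
    by apply: definableI => //; apply: far_definable.
  have dDM : definable G DM.
    have -> : DM = (D :|: DM) :&: M.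
      apply/setP=> z; rewrite in_setI in_setU.
      case zM: (z \in DM); first by rewrite orbT (subsetP DMsub).
      by rewrite orbF; apply/esym/negbTE/negP => /andP[/(subsetP Dsub)/disj/negbTE->].
    by apply: definableI => //; apply: definableD => //; apply: near_definable.
  have farG := Dres G cG FG da dD0.
  have G1G : G1 \subset G.
    apply: individualize_sub => // x; rewrite in_setU1 => /orP[/eqP->//|]; exact: farG.
  move=> x; rewrite farE in_setU => /orP[/farG//|xM].
  exact: (DMres G cG G1G dDM).
- move=> b bfar.
  (* For [b] in [far j.+2] the set [D] already leaves out an out-neighbour; otherwise the next
     vertex on a shortest path to [a] lies in [M]. *)
  case bn: (b \in near j.+2); last first.
    have [|z /setDP[zfar zD] bz] := Dnext b.
      by move: bfar; rewrite !in_setD bn => /andP[_ ->].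
    exists z => //; rewrite in_setD farE !in_setU zfar (negbTE zD) /= andbT.
    by apply: contra (disj _ zfar); apply: (subsetP DMsub).
  have bnS : b \notin near j.+1 by move: bfar; rewrite in_setD => /andP[].
  move: (bn); rewrite in_nb => /ballP[[eab _]|[_ bL abt [z az zb]]].
    by rewrite -eab a_near in bnS.
  rewrite in_transp in zb.
  have zM : z \in M.
    rewrite in_setD; apply/andP; split; last by rewrite in_nb.
    apply: contra bnS => azj; rewrite in_nb; apply/ballP; right; split => //.
    by exists z; rewrite ?in_transp //; move: azj; rewrite in_nb.
  have dN : definable G1 (nb t b :&: M).
    apply: definableI => //; apply: definable_nb => //; first exact: (subsetP FG1).
    by apply: individualize_def; rewrite in_setU1 bfar orbT.
  case sub: (nb t b :&: M \subset DM).
    have := DMfree _ dN sub; move/setP/(_ z).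
    by rewrite in_setI in_nb zb zM in_set0.
  move/negbT/subsetPn: sub => [z' /setIP[bz' z'M] z'D].
  exists z'; last by rewrite in_nb in bz'.
  rewrite in_setD farE !in_setU z'M orbT (negbTE z'D) orbF andbT.
  by apply: contraTN z'M => /(subsetP Dsub)/disj.
Qed.

(* With [E := nb t a :|: D], the point [a] is the only one of [L] outside [E] all of whose
   [t]-neighbours are in [E], so a coherent family defining [E] defines [a]. *)
Lemma resolve_connected : exists D, resolving F L D.
Proof.
have [D [Dsub Dres Dnext]] := @resolve_levels #|{: T * T}| 1 isT (leq_addl _ _).
have VL : nb V a \subset L by rewrite nb_sub ?reach_sub.
have atL : nb t a \subset L by apply: nb_sub.
have aV : a \in nb V a by rewrite in_nb reach_refl.
have near1 : near 1 = [set a].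
  apply/setP=> z; rewrite in_nb in_set1; apply/idP/eqP.
    by case/ballP=> [[->]|[_ _ _ [w]]] //; rewrite inE.
  by move->; rewrite -in_nb; apply: a_near.
have disj z : z \in nb V a -> z \notin nb t a by rewrite !in_nb; apply: V_not_t.
have far1 z : (z \in far 1) = (z != a) && (z \in nb V a).
  by rewrite in_setD near1 in_set1.
have aD : a \notin nb t a :|: D.
  rewrite in_setU negb_or disj //=; apply/negP => /(subsetP Dsub).
  by rewrite far1 eqxx.
have cover z : z \in L -> (z \in nb t a) || (z \in nb V a).
  move=> zL; rewrite !in_nb; case az: ((a, z) \in t) => //=.
  by apply: reach_avoid; rewrite ?az.
exists (nb t a :|: D); split.
- rewrite subUset atL; apply: subset_trans Dsub (subset_trans (subsetDl _ _) VL).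
- move=> A dA AD; case: (hom dA) => [|//|AL].
    apply: subset_trans AD _; rewrite subUset atL.
    by apply: subset_trans Dsub (subset_trans (subsetDl _ _) VL).
  by rewrite AL in AD; have := subsetP AD _ aL; rewrite (negbTE aD).
- move=> G cG FG dD; set E := _ :|: _ in aD dD.
  have tG : t \in G by apply: (subsetP FG).
  have da : definable G [set a].
    have dLG := definable_sub FG dL.
    apply/(definableP cG) => p q e.
    (* The condition on out-neighbours is phrased as a two-step path with arbitrary end, to fit
       [same_color_ex]. *)
    have WE u : (u.1 \in [set a]) = [&& u.1 \in L, u.1 \notin E &
        ~~ [exists z, ((u.1, z) \in t) && ((z, u.2) \in setX (~: E) setT)]].
      rewrite in_set1; apply/eqP/and3P=> [->|[uL uE ut]].
        split=> //; apply/negP => /existsP[z /andP[az]].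
        by rewrite in_setX in_setC in_setU in_nb az.
      apply/eqP/contraT => una.
      have uV : u.1 \in nb V a.
        by case/orP: (cover _ uL) => // h; rewrite in_setU h in uE.
      suff [z uz zE] : exists2 z, (u.1, z) \in t & z \notin E.
        by case/existsP: ut; exists z; rewrite uz in_setX in_setC zE in_setT.
      (* A point one step from [a] has [a] itself as an out-neighbour outside [E]; for a farther
         point [Dnext] supplies one. *)
      case u2: (u.1 \in near 2).
        move: (u2); rewrite in_nb => /ballP[[e' _]|[_ _ _ [z az zu]]].
          by rewrite -e' eqxx in una.
        have : z \in near 1 by rewrite in_nb.
        rewrite near1 in_set1 => /eqP za; exists a => //.
        by rewrite za in_transp in zu.
      have [|z /setDP[zfar zD] uz] := Dnext u.1; first by rewrite in_setD u2.
      exists z => //; rewrite in_setU negb_or zD andbT; apply: disj.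
      by move: zfar; rewrite far1 => /andP[].
    rewrite !WE (definable_fst cG dLG e) (definable_fst cG dD e); congr [&& _, _ & ~~ _].
    by apply: same_color_ex e _ _; rewrite ?coh_setX ?definableC ?definableT.
  have dD0 : definable G D.
    have -> : D = E :&: far 1.
      apply/setP=> z; rewrite in_setI in_setU.
      case zD: (z \in D); first by rewrite orbT (subsetP Dsub).
      rewrite orbF; apply/esym/negbTE/negP => /andP[h]; rewrite far1 => /andP[_ /disj].
      by rewrite h.
    by apply: definableI => //; apply: far_definable.
  have dV x : x \in nb V a -> definable G [set x].
    case: (eqVneq x a) => [->//|xa] xV; apply: (Dres G) => //.
    by rewrite far1 xa.
  have dt : definable G (nb t a) by apply: definable_nb.
  have dat := definable_separated cG dt _.
  move=> x xL; case/orP: (cover _ xL) => [|/dV//]; apply: dat => u v.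
  move=> uat vat uv; have uL := subsetP atL _ uat; have vL := subsetP atL _ vat.
  have lt := card_sym_diff uL vL uv (erefl (color F (u, v))).
  set s := color F (u, v) in lt.
  have sF : s \in F by apply: color_in.
  have sL : s \subset setX L L by apply: color_sub.
  have : ~~ ((nb s u :\: nb s v) :|: (nb s v :\: nb s u) \subset nb t a).
    apply/negP => /subset_leq_card; rewrite leqNgt => /negP; apply.
    by apply: leq_trans lt; rewrite tk //; apply: mink.
  case/subsetPn => z zs zt.
  have zd : (z \in nb s u) != (z \in nb s v).
    by move: zs; rewrite in_setU !in_setD; case: (_ \in _); case: (_ \in _).
  have zL : z \in L.
    by move: zs; rewrite in_setU !in_setD => /orP[] /andP[_]; apply: (subsetP (nb_sub _ sL)).
  have zV : z \in nb V a by have := cover _ zL; rewrite (negbTE zt).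
  exists (nb (transp s) z); last by rewrite !in_nb !in_transp -!in_nb.
  by apply: definable_nb (dV _ zV) => //; apply: coh_transp => //; apply: (subsetP FG).
Qed.

End Leader.

End Connected.

End MinValency.

End Homogeneous.

Lemma same_color_eq (T : finType) (F : {set {set T * T}}) (p q : T * T) :
  same_color F p q -> color F p = color F q.
Proof.
move=> h; apply/setP=> z; rewrite !inE; apply/idP/idP; apply: same_color_trans => //.
by rewrite same_color_sym.
Qed.

(** Sort the summands by the value [j] of [f]: the pairs of value [j] form a relation of [F], and
    the sum becomes a combination of intersection numbers. *)
Lemma same_color_sum (T : finType) (F : {set {set T * T}}) (f : T * T -> nat)
    (r : {set T * T}) (p q : T * T) : coherent F -> r \in F ->
  (forall u v, same_color F u v -> f u = f v) -> same_color F p q ->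
  \sum_(z in nb r p.1) f (z, p.2) = \sum_(z in nb r q.1) f (z, q.2).
Proof.
move=> cF rF fF e.
pose S j := [set u | f u == j].
have SF j : S j \in F.
  by apply: coh_invariant => // u v /fF h; rewrite !inE h.
pose n := \max_(u : T * T) f u.
have E u : \sum_(z in nb r u.1) f (z, u.2) = \sum_(j < n.+1) j * cnum r (S j) u.1 u.2.
  rewrite (partition_big (fun z => inord (f (z, u.2)) : 'I_n.+1) xpredT) //=.
  apply: eq_bigr => j _; rewrite mulnC -sum_nat_const.
  (* [n] bounds [f], so [inord] never falls back on its default. *)
  have fj z : (inord (f (z, u.2)) == j) = (f (z, u.2) == j).
    by rewrite -val_eqE /= inordK // ltnS; apply: (leq_bigmax (z, u.2)).
  rewrite (eq_bigr (fun=> j : nat)) => [|z /andP[_]]; last by rewrite fj => /eqP.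
  by apply: eq_bigl => z; rewrite !inE fj.
by rewrite !E; apply: eq_bigr => j _; rewrite (same_color_cnum cF e).
Qed.

(** * Quotients by an invariant equivalence relation *)

Section Quotient.
Variables (T T2 : finType) (F : {set {set T * T}}) (L : {set T}) (f : T -> T2).
Hypothesis cF : coherent F.
Hypothesis dL : definable F L.
Hypothesis hom : forall A, definable F A -> A \subset L -> A = set0 \/ A = L.
Hypothesis anti : antisymmetric_on F L.

Definition kernel : {set T * T} := [set p in setX L L | f p.1 == f p.2].
Definition pre (R : {set T2 * T2}) : {set T * T} :=
  [set p in setX L L | (f p.1, f p.2) \in R].
Definition lift (B : {set T2}) : {set T} := [set x in L | f x \in B].
Definition quot (G : {set {set T * T}}) : {set {set T2 * T2}} := [set R | pre R \in G].

Hypothesis surj : forall b, exists2 x, x \in L & f x = b.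
Hypothesis eF : kernel \in F.
Variable x0 : T.
Hypothesis x0L : x0 \in L.
Local Notation q := #|nb kernel x0|.

Lemma in_pre R x y : ((x, y) \in pre R) = [&& x \in L, y \in L & (f x, f y) \in R].
Proof. by rewrite !inE /= andbA. Qed.

Lemma in_kernel x y : ((x, y) \in kernel) = [&& x \in L, y \in L & f x == f y].
Proof. by rewrite !inE /= andbA. Qed.

Lemma in_lift B x : (x \in lift B) = (x \in L) && (f x \in B).
Proof. by rewrite inE. Qed.

Lemma nb_kernel x : x \in L -> nb kernel x = lift [set f x].
Proof. by move=> xL; apply/setP=> y; rewrite in_nb in_kernel in_lift in_set1 xL eq_sym. Qed.

Lemma lift_sub B : lift B \subset L.
Proof. by apply/subsetP=> x; rewrite in_lift => /andP[]. Qed.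

Lemma card_block b : #|lift [set b]| = q.
Proof.
have [x xL <-] := surj b; rewrite -nb_kernel //.
exact: (hom_nb cF dL hom).
Qed.

Lemma card_lift B : #|lift B| = #|B| * q.
Proof.
rewrite -sum1_card (partition_big f (mem B)) /=; last by move=> x; rewrite in_lift => /andP[].
rewrite -sum_nat_const; apply: eq_bigr => b bB; rewrite -(card_block b) -sum1_card.
by apply: eq_bigl => x; rewrite !in_lift in_set1; case: eqP => [->|]; rewrite ?bB ?andbF ?andbT.
Qed.

Lemma q_gt0 : 0 < q.
Proof. by apply/card_gt0P; exists x0; rewrite in_nb in_kernel x0L eqxx. Qed.

(** Each intermediate block contributes its [q] points; the factor cancels when the quotient is
    shown to be coherent. *)
Lemma cnum_pre r s x y : x \in L -> y \in L ->
  cnum (pre r) (pre s) x y = cnum r s (f x) (f y) * q.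
Proof.
move=> xL yL; rewrite -card_lift; apply: eq_card => z.
by rewrite !inE /= xL yL; case: (z \in L); rewrite /= ?andbT ?andbF.
Qed.

Section Coherent.
Variable G : {set {set T * T}}.
Hypotheses (cG : coherent G) (FG : F \subset G).

Let dLG : definable G L := definable_sub FG dL.

Lemma quot_coherent : coherent (quot G).
Proof.
have LL := coh_setX cG dLG dLG.
apply/and5P; split.
- rewrite inE (_ : pre _ = kernel) ?(subsetP FG) //.
  by apply/setP=> -[x y]; rewrite in_pre in_kernel inE.
- apply/forall_inP=> r; rewrite !inE => rG.
  rewrite (_ : pre _ = setX L L :\: pre r) ?coh_setD //.
  apply/setP=> -[x y]; rewrite in_setD !in_pre inE in_setX.
  by case: (x \in L); case: (y \in L); rewrite ?andbF ?andbT.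
- apply/forall_inP=> r; rewrite !inE => rG; apply/forall_inP=> s; rewrite !inE => sG.
  rewrite (_ : pre _ = pre r :&: pre s) ?coh_setI //.
  apply/setP=> -[x y]; rewrite in_setI !in_pre in_setI.
  by case: (x \in L); case: (y \in L).
- apply/forall_inP=> r; rewrite !inE => rG.
  rewrite (_ : pre _ = transp (pre r)) ?coh_transp //.
  by apply/setP=> -[x y]; rewrite in_transp !in_pre in_transp andbCA.
- apply/forall_inP=> r; rewrite !inE => rG; apply/forall_inP=> s; rewrite !inE => sG.
  apply/forallP=> u; rewrite inE; set n := cnum r s u.1 u.2.
  apply: coh_invariant => // -[x y] [x' y'] e; rewrite !in_pre !inE /=.
  case/and3P=> xL yL xy.
  have := definable_fst cG dLG e; rewrite /= xL => x'L; rewrite -x'L.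
  have := definable_snd cG dLG e; rewrite /= yL => y'L; rewrite -y'L /=.
  have := same_color_cnum cG e rG sG; rewrite /= !cnum_pre -?x'L -?y'L //.
  by move/eqP; rewrite eqn_pmul2r ?q_gt0 // => /eqP<-.
Qed.

Lemma definable_quot B : definable (quot G) B = definable G (lift B).
Proof.
apply/idP/idP => [|dB].
  rewrite /definable inE => h; apply/definableP => // p p' e; rewrite !in_lift.
  have := same_color_in (same_color_fst cG e) h; rewrite !in_pre !in_diag /= !eqxx /=.
  by rewrite (definable_fst cG dLG e) !andbA !andbb.
rewrite /definable inE (_ : pre _ = kernel :&: setX (lift B) L).
  by rewrite coh_setI ?coh_setX ?(subsetP FG).
apply/setP=> -[x y]; rewrite in_setI in_pre in_kernel in_diag in_setX in_lift /=.
by case: (x \in L); case: (y \in L); rewrite //= ?andbF ?andbT // andbC.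
Qed.

End Coherent.

(** An orientation of the complete graph on [L]: by antisymmetry the colours of [(x, y)] and
    [(y, x)] differ off the diagonal, so one has the smaller rank. *)
Definition tournament : {set T * T} := [set p in setX L L |
  enum_rank (color F p) < enum_rank (color F (p.2, p.1))].

Lemma tournament_in : tournament \in F.
Proof.
apply: coh_invariant => // p p' e.
rewrite !inE (definable_fst cF dL e) (definable_snd cF dL e).
by rewrite (same_color_eq e) (same_color_eq (same_color_swap cF e)).
Qed.

Lemma tournamentP x y : x \in L -> y \in L ->
  ((x, y) \in tournament) + ((y, x) \in tournament) = (x != y).
Proof.
move=> xL yL; rewrite !inE /= xL yL /=; case: (eqVneq x y) => [->|xy] /=.
  by rewrite ltnn.
have : color F (x, y) != color F (y, x).
  apply: contraNneq xy => E; apply/eqP; apply: anti => //.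
  by have: (y, x) \in color F (x, y); [rewrite E mem_color|rewrite inE].
by rewrite -(inj_eq enum_rank_inj) -val_eqE neq_ltn /=; case: ltngtP.
Qed.

Definition arcs (A B : {set T}) : nat := \sum_(x in A) #|nb tournament x :&: B|.

Lemma arcs_sym (A B : {set T}) : A \subset L -> B \subset L ->
  arcs A B + arcs B A = \sum_(x in A) \sum_(y in B) (x != y).
Proof.
move=> /subsetP AL /subsetP BL; rewrite /arcs !sum_card_nb.
rewrite [X in _ + X]exchange_big /= -big_split /=.
apply: eq_bigr => x xA; rewrite -big_split /=; apply: eq_bigr => y yB.
by apply: tournamentP; [apply: AL | apply: BL].
Qed.

(* [x0] has equal in- and outdegree in the tournament restricted to its block. *)
Lemma q_odd : odd q.
Proof.
pose r := kernel :&: tournament.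
have rF : r \in F by rewrite coh_setI ?tournament_in.
have rL : r \subset setX L L.
  by apply/subsetP=> -[x y]; rewrite in_setI in_kernel in_setX => /andP[/and3P[-> ->]].
have -> : nb kernel x0 = x0 |: (nb r x0 :|: nb (transp r) x0).
  apply/setP=> y; rewrite in_setU1 in_setU !in_nb in_transp !in_setI !in_kernel x0L /=.
  rewrite [y == x0]eq_sym (eq_sym (f y)); case yL: (y \in L) => /=; last first.
    by rewrite orbF; apply/esym/eqP=> e; rewrite -e x0L in yL.
  have := tournamentP x0L yL; case: eqVneq => [->|_] /=; first by rewrite eqxx.
  by case: (_ == _) => //=; case: (_ \in _); case: (_ \in _).
have := tournamentP x0L x0L; rewrite eqxx /= => /eqP; rewrite addn_eq0 => /andP[irr _].
have {}irr : (x0, x0) \notin tournament by rewrite -eqb0.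
rewrite cardsU1 in_setU !in_nb in_transp orbb in_setI (negbTE irr) andbF /=.
rewrite cardsU (_ : _ :&: _ = set0) ?cards0 ?subn0.
  by rewrite (nb_transp cF dL hom rF rL x0L) addnn oddD odd_double.
apply/setP=> y; rewrite in_setI !in_nb in_transp !in_setI in_set0 in_kernel.
apply/negbTE/negP => /andP[/andP[/and3P[_ yL _] h] /andP[_ h']].
by have := tournamentP x0L yL; rewrite h h'; case: eqP.
Qed.

(* The numbers of tournament arcs from [b] to [b'] and back add up to the odd number [q ^ 2]. *)
Lemma quot_antisymmetric : antisymmetric_on (quot F) setT.
Proof.
move=> b b' _ _ e; apply/eqP/contraT => bb'.
pose n := arcs (lift [set b]) (lift [set b']).
(* The pairs of blocks joined by exactly [n] arcs form a relation of the quotient, so [n] arcs also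
   lead from [b'] to [b]. *)
pose R := [set u : T2 * T2 | arcs (lift [set u.1]) (lift [set u.2]) == n].
have arcsF u v : same_color F u v -> u.1 \in L -> u.2 \in L ->
    arcs (nb kernel u.1) (nb kernel u.2) = arcs (nb kernel v.1) (nb kernel v.2).
  move=> uv u1 u2; pose g p := cnum tournament kernel p.1 p.2.
  have gE x y : g (x, y) = #|nb tournament x :&: nb kernel y|.
    rewrite /g cnumE /=; congr #|_ :&: _|; apply/setP=> z.
    rewrite !in_nb in_transp !in_kernel andbCA; congr [&& _, _ & _].
    by rewrite eq_sym.
  have arcE w : arcs (nb kernel w.1) (nb kernel w.2) = \sum_(z in nb kernel w.1) g (z, w.2).
    by rewrite /arcs; apply: eq_bigr => x _; rewrite gE.
  rewrite !arcE; apply: same_color_sum uv => // p p' pp'.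
  exact: (same_color_cnum cF pp' tournament_in eF).
have RF : R \in quot F.
  rewrite inE; apply: coh_invariant => // -[x y] [x' y'] xy; rewrite !in_pre !inE /=.
  case/and3P=> xL yL h.
  have := definable_fst cF dL xy; rewrite /= xL => x'L; rewrite -x'L.
  have := definable_snd cF dL xy; rewrite /= yL => y'L; rewrite -y'L /=.
  by rewrite -!nb_kernel -?x'L -?y'L // -(arcsF _ _ xy) // !nb_kernel.
have := same_color_in e RF; rewrite !inE /= eqxx => /esym/eqP h.
have := arcs_sym (lift_sub [set b]) (lift_sub [set b']).
rewrite h -/n (eq_bigr (fun=> q)) => [|x xb].
  rewrite sum_nat_const card_block addnn => /(congr1 odd).
  by rewrite odd_double oddM q_odd.
rewrite -(card_block b') -sum1_card; apply: eq_bigr => y yb'.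
suff -> : x != y by [].
apply: contraNneq bb' => xy; move: xb yb'; rewrite xy !in_lift !in_set1.
by case/andP=> _ /eqP<- /andP[_ /eqP<-].
Qed.

Lemma card_L : #|L| = #|T2| * q.
Proof.
rewrite -[#|T2|]cardsT -card_lift; congr #|pred_of_set _|; apply/setP=> x.
by rewrite in_lift in_setT andbT.
Qed.

(* [D] meets a block in more than half of its points exactly when the block is in [D2], which
   makes [D2] definable from [D]; the minority part in each block then resolves the block. *)
Lemma resolve_quotient : 1 < q -> q < #|L| ->
  (forall (T' : finType) (G : {set {set T' * T'}}) A, coherent G -> definable G A ->
     antisymmetric_on G A -> #|A| < #|L| -> exists D, resolving G A D) ->
  exists D, resolving F L D.
Proof.
move=> q1 qL IH; have q0 := q_gt0.
have T2L : #|[set: T2]| < #|L|.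
  rewrite cardsT card_L -[X in X < _]muln1 ltn_pmul2l //.
  by case: #|T2| card_L qL => // ->; rewrite mul0n.
have cQ := quot_coherent cF (subxx F).
have [D2 [_ D2free D2res]] := IH _ _ _ cQ (definableT cQ) quot_antisymmetric T2L.
pose blk b := lift [set b].
(* The induction hypothesis applies to a block once it is made definable. *)
pose Gb b := coherent_closure (diag_of (blk b) |: F).
have cGb b : coherent (Gb b) by apply: coherent_closureP.
have FGb b : F \subset Gb b by apply: subset_trans (subsetUr _ _) (sub_coherent_closure _).
have dGb b : definable (Gb b) (blk b).
  by apply: (subsetP (sub_coherent_closure _)); rewrite setU11.
have /fin_all_exists[Dl Dlres] : forall b, exists D, resolving (Gb b) (blk b) D.
  move=> b; apply: IH => //; last by rewrite card_block.
  exact: antisymmetric_sub (FGb b) (lift_sub _) anti.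
pose m b := if 2 * #|Dl b| < q then Dl b else blk b :\: Dl b.
have m_sub b : m b \subset blk b.
  rewrite /m; case: ifP => _; last exact: subsetDl.
  by have [] := Dlres b.
have m_card b : 2 * #|m b| < q.
  rewrite /m; case: ifP => // /negbT; have [sub _ _] := Dlres b.
  (* A tie is impossible because [q] is odd. *)
  rewrite -leqNgt leq_eqVlt => /orP[/eqP e|]; first by have := q_odd; rewrite e mul2n odd_double.
  by rewrite cardsD (setIidPr sub) card_block; clear -q0; lia.
(* The exclusive or replaces [m b] by its complement exactly in the blocks belonging to [D2]. *)
pose D := [set x in L | (x \in m (f x)) (+) (f x \in D2)].
have inD x : (x \in D) = (x \in L) && ((x \in m (f x)) (+) (f x \in D2)) by rewrite inE.
have DL : D \subset L by apply/subsetP=> x; rewrite inD => /andP[].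
have Dblk b : blk b :&: D = if b \in D2 then blk b :\: m b else m b.
  apply/setP=> x; rewrite in_setI inD in_lift in_set1.
  case: (eqVneq (f x) b) => [<-|fxb]; last first.
    rewrite andbF /=; apply/esym; case: ifP => _.
      by rewrite in_setD in_lift in_set1 (negbTE fxb) !andbF.
    by apply/negbTE/negP => /(subsetP (m_sub b)); rewrite in_lift in_set1 (negbTE fxb) andbF.
  case: ifP => _; rewrite ?in_setD ?addbT ?addbF ?in_lift ?in_set1 ?eqxx ?andbT.
    by case: (x \in L); rewrite ?andbF ?andbT.
  case xL: (x \in L) => //=; apply/esym/negbTE/negP => /(subsetP (m_sub _)).
  by rewrite in_lift xL.
have major b : (q < 2 * #|blk b :&: D|) = (b \in D2).
  rewrite Dblk; case: ifP => _.
    by rewrite cardsD (setIidPr (m_sub b)) card_block; have := m_card b; clear; lia.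
  by apply/negbTE; rewrite -leqNgt ltnW.
exists D; split => //.
  move=> A dA AD; case: (hom dA (subset_trans AD DL)) => // AL; rewrite AL in AD.
  (* Every block now lies in [D], so [D2] would be the whole quotient, against [D2free]. *)
  have D2T : D2 = setT.
    apply/setP=> b; rewrite in_setT -major (setIidPl (subset_trans (lift_sub _) AD)).
    by rewrite card_block; clear -q0; lia.
  have := D2free _ (definableT cQ); rewrite D2T subxx => /(_ isT)/setP/(_ (f x0)).
  by rewrite in_setT in_set0.
move=> G cG FG dD x xL.
have cQG := quot_coherent cG FG.
have dLG := definable_sub FG dL.
have dD2 : definable (quot G) D2.
  rewrite (definable_quot cG FG); apply/definableP => // p p' e.
  (* Majority in the block of [y] is a statement about a valency, hence invariant under colours. *)
  have E y : (y \in lift D2) = (y \in L) && (q < 2 * #|nb (kernel :&: setX setT D) y|).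
    rewrite in_lift; case yL: (y \in L) => //=; rewrite -major /blk -nb_kernel //.
    congr (_ < 2 * #|pred_of_set _|); apply/setP=> z.
    by rewrite in_setI !in_nb in_setI in_setX in_setT.
  rewrite !E (definable_fst cG dLG e) (same_color_nb cG e) //.
  by rewrite coh_setI ?coh_setX ?definableT ?(subsetP FG).
have QQ : quot F \subset quot G.
  by apply/subsetP=> r; rewrite !inE; apply: (subsetP FG).
have dblk : definable G (blk (f x)).
  by rewrite -definable_quot //; apply: D2res => //; rewrite in_setT.
have [sub _ res] := Dlres (f x).
apply: (res G cG) => //.
- by apply: coherent_closure_sub => //; rewrite subUset sub1set FG andbT.
- have dX : definable G (blk (f x) :&: D) by apply: definableI.
  have dm : definable G (m (f x)).
    move: dX; rewrite Dblk; case: ifP => // _ dX.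
    have -> : m (f x) = blk (f x) :\: (blk (f x) :\: m (f x)).
      by rewrite setDDr setDv set0U (setIidPr (m_sub _)).
    exact: definableD.
  move: dm; rewrite /m; case: ifP => // _ dm.
  have -> : Dl (f x) = blk (f x) :\: (blk (f x) :\: Dl (f x)).
    by rewrite setDDr setDv set0U (setIidPr sub).
  exact: definableD.
- by rewrite in_lift xL set11.
Qed.

End Quotient.

(** Intersecting with the definable sets [A] and [B] recovers [DA] and [DB] and cuts a definable
    subset of the union into two definable pieces. *)
Lemma resolve_split (T : finType) (F : {set {set T * T}}) (A B DA DB : {set T}) :
  coherent F -> definable F A -> definable F B -> A :&: B = set0 ->
  resolving F A DA -> resolving F B DB -> resolving F (A :|: B) (DA :|: DB).
Proof.
move=> cF dA dB AB [DAs DAf DAr] [DBs DBf DBr].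
have EA : (DA :|: DB) :&: A = DA.
  rewrite setIUl (setIidPl DAs) (eqP (_ : DB :&: A == set0)) ?setU0 //.
  by rewrite -subset0 -AB setIC setIS.
have EB : (DA :|: DB) :&: B = DB.
  rewrite setIUl (setIidPl DBs) (eqP (_ : DA :&: B == set0)) ?set0U //.
  by rewrite -subset0 -AB setSI.
split; first exact: setUSS.
  move=> C dC CD; rewrite -(setIidPl CD).
  have CA : C :&: A = set0 by apply: DAf; rewrite ?definableI // -EA setSI.
  have CB : C :&: B = set0 by apply: DBf; rewrite ?definableI // -EB setSI.
  have := setIidPl (subset_trans CD (setUSS DAs DBs)).
  by rewrite setIUr CA CB setU0 (setIidPl CD) => <-.
move=> G cG FG dD x; rewrite in_setU => /orP[xA|xB].
  by apply: DAr xA => //; rewrite -EA definableI // (definable_sub FG).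
by apply: DBr xB => //; rewrite -EB definableI // (definable_sub FG).
Qed.

(** * Connected components and the main induction *)

Section Components.
Variables (T : finType) (F : {set {set T * T}}) (L : {set T}) (t : {set T * T}).
Hypothesis cF : coherent F.
Hypothesis dL : definable F L.
Hypothesis hom : forall A, definable F A -> A \subset L -> A = set0 \/ A = L.
Hypotheses (tF : t \in F) (tL : t \subset setX L L).

Local Notation e := (reach L t set0).

Lemma reach_trans x y z : (x, y) \in e -> (y, z) \in e -> (x, z) \in e.
Proof.
move=> xy yz; move: y z yz x xy.
apply: reach_ind => // y w z _ zL _ _ IH wz x /IH xw.
have := subsetP (reach_sub L t set0) _ xw; rewrite in_setX => /andP[xL _].
by apply: (reach_next xw wz); rewrite ?in_set0.
Qed.

Lemma reach_in0 : e \in F.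
Proof. by apply: reach_in => //; apply: coh_set0. Qed.

(** A path from [x] to [y] gives an inclusion of their reachable sets, which have equal size. Hence
    reachability is an equivalence relation on [L]. *)
Lemma reach_nb x y : x \in L -> y \in L -> ((x, y) \in e) = (nb e x == nb e y).
Proof.
move=> xL yL; apply/idP/eqP=> [xy|E]; last by rewrite -in_nb E in_nb reach_refl.
apply/esym/eqP; rewrite eqEcard (hom_nb cF dL hom reach_in0 xL yL) leqnn andbT.
by apply/subsetP=> z; rewrite !in_nb; apply: reach_trans.
Qed.

End Components.

Theorem resolving_exists (T : finType) (F : {set {set T * T}}) (L : {set T}) :
  coherent F -> definable F L -> antisymmetric_on F L -> exists D, resolving F L D.
Proof.
(* The type [T] is generalized too, since the quotient lives on another type. *)
have [n] := ubnP #|L|; elim: n => // n IHn in T F L *; rewrite ltnS => Ln cF dL anti.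
have IH (T' : finType) (G : {set {set T' * T'}}) A : coherent G -> definable G A ->
    antisymmetric_on G A -> #|A| < #|L| -> exists D, resolving G A D.
  by move=> cG dA aA AL; apply: IHn => //; apply: leq_trans AL Ln.
case: (boolP [exists A : {set T}, [&& definable F A, A \subset L, A != set0 & A != L]]).
  case/existsP=> A /and4P[dA AL A0 AnL].
  have dB : definable F (L :\: A) by apply: definableD.
  have Alt : #|A| < #|L| by rewrite proper_card // properEneq AnL.
  have Blt : #|L :\: A| < #|L|.
    by rewrite cardsD (setIidPr AL); move: A0 Alt; rewrite -card_gt0; clear; lia.
  have [DA rA] := IH _ _ _ cF dA (antisymmetric_sub (subxx F) AL anti) Alt.
  have [DB rB] := IH _ _ _ cF dB (antisymmetric_sub (subxx F) (subsetDl L A) anti) Blt.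
  exists (DA :|: DB); rewrite -(setID L A) (setIidPr AL).
  apply: resolve_split => //; apply/setP=> z; rewrite in_setI in_setD in_set0.
  by case: (z \in A).
move/existsPn => hom'.
have hom A : definable F A -> A \subset L -> A = set0 \/ A = L.
  move=> dA AL; have := hom' A; rewrite dA AL /= negb_and !negbK.
  by case/orP=> /eqP; [left | right].
have [L1|] := leqP #|L| 1.
  exists set0; split; rewrite ?sub0set //.
    by move=> A _; rewrite subset0 => /eqP.
  move=> G cG FG _ x xL; rewrite (_ : [set x] = L) ?(definable_sub FG) //.
  by apply/eqP; rewrite eqEcard sub1set xL cards1.
case/card_gt1P=> x1 [y1 [x1L y1L xy1]].
pose P (p : T * T) := [&& p.1 \in L, p.2 \in L & p.1 != p.2].
have P1 : P (x1, y1) by rewrite /P /= x1L y1L.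
case: (arg_minnP (fun p => #|nb (color F p) p.1|) P1) => -[x0 y0] /=.
case/and3P=> /= x0L y0L xy0 kmin.
set k := #|nb (color F (x0, y0)) x0| in kmin; set t := color F (x0, y0).
have mink x y : x \in L -> y \in L -> x != y -> k <= #|nb (color F (x, y)) x|.
  by move=> xL yL xy; apply: (kmin (x, y)); rewrite /P /= xL yL.
have tF : t \in F by apply: color_in.
have tL : t \subset setX L L by apply: color_sub.
have t0 : (x0, y0) \in t by apply: mem_color.
case: (boolP [forall x in L, forall y in L, (x, y) \in reach L t set0]) => [/forall_inP conn|].
  have conn' x y : x \in L -> y \in L -> (x, y) \in reach L t set0.
    by move=> /conn/forall_inP; apply.
  have tk x : x \in L -> #|nb t x| = k by move=> xL; apply: (hom_nb cF dL hom tF xL x0L).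
  have k0 : 0 < k by apply/card_gt0P; exists y0; rewrite in_nb.
  have tanti x y : (x, y) \in t -> (y, x) \notin t.
    exact: (color_anti cF dL anti x0L y0L xy0).
  exact: (resolve_connected cF dL hom anti mink tF tL tanti k0 tk conn' x0L (IH T)).
case/forall_inPn=> x xL /forall_inPn[y yL xy].
set e := reach L t set0 in xy.
pose T2 : finType := {b : {set T} | b \in nb e @: L}.
have nbE z : z \in L -> nb e z \in nb e @: L by apply: imset_f.
(* Points outside [L] receive the block of [x0] as default value. *)
pose f z : T2 := insubd (Sub (nb e x0) (nbE x0 x0L)) (nb e z).
have fE z : z \in L -> val (f z) = nb e z by move=> zL; rewrite insubdK // nbE.
have surj b : exists2 z, z \in L & f z = b.
  by have /imsetP[z zL E] := valP b; exists z => //; apply: val_inj; rewrite fE.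
have kE : kernel L f = e.
  apply/setP=> -[u v]; rewrite in_kernel.
  case uL: (u \in L) => /=; last first.
    by apply/esym/negbTE/negP => /(subsetP (reach_sub L t set0)); rewrite in_setX uL.
  case vL: (v \in L) => /=; last first.
    by apply/esym/negbTE/negP => /(subsetP (reach_sub L t set0)); rewrite in_setX vL andbF.
  by rewrite (reach_nb cF dL hom tF uL vL) -val_eqE !fE.
have eF : kernel L f \in F by rewrite kE; apply: reach_in0.
apply: (resolve_quotient cF dL hom anti surj eF x0L) IH; rewrite kE.
  apply/card_gt1P; exists x0, y0; rewrite !in_nb reach_refl //; split=> //.
  by apply: reach_next t0 _ _ _; rewrite ?reach_refl ?in_set0.
rewrite -(hom_nb cF dL hom (reach_in0 cF dL tF) xL x0L); apply: proper_card.
apply/properP; split; first exact: nb_sub (reach_sub L t set0).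
by exists y => //; rewrite in_nb.
Qed.

(** * From coherent configurations to coherent families *)

Section Relations.
Variables (T : finType) (S : {set {set T * T}}).
Implicit Types (r s u : {set T * T}) (p q : T * T).

Lemma is_relP r : partition S setT ->
  reflect (forall u p q, u \in S -> p \in u -> q \in u -> p \in r -> q \in r) (is_rel S r).
Proof.
case/and3P=> /eqP cS tS _; apply: (iffP existsP) => [[P /andP[/subsetP PS /eqP <-]]|h].
  move=> u p q uS pu qu /bigcupP[v vP pv]; apply/bigcupP; exists v => //.
  by rewrite -(def_pblock tS (PS _ vP) pv) (def_pblock tS uS pu).
exists [set u in S | u \subset r]; apply/andP; split.
  by apply/subsetP=> u; rewrite inE => /andP[].
apply/eqP/setP=> p; apply/bigcupP/idP=> [[u]|pr].
  by rewrite inE => /andP[_ /subsetP]; apply.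
have pS : p \in cover S by rewrite cS.
exists (pblock S p); last by rewrite mem_pblock.
rewrite inE pblock_mem //=; apply/subsetP=> q qp.
by apply: h pr; [apply: (pblock_mem pS) | rewrite mem_pblock | ].
Qed.

(** Sort the intermediate points [z] by the basic relations of [(x, z)] and [(z, y)]. This carries
    the constancy of intersection numbers from basic relations to all relations. *)
Lemma cnum_sum r s x y : partition S setT -> is_rel S r -> is_rel S s ->
  cnum r s x y = \sum_(j : {set T * T} * {set T * T}
    | [&& j.1 \in S, j.2 \in S, j.1 \subset r & j.2 \subset s]) cnum j.1 j.2 x y.
Proof.
move=> pS /(is_relP _ pS) hr /(is_relP _ pS) hs; have /and3P[/eqP cS tS _] := pS.
have inS p : p \in cover S by rewrite cS in_setT.
rewrite /cnum -sum1_card.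
rewrite (partition_big (fun z => (pblock S (x, z), pblock S (z, y)))
  (fun j => [&& j.1 \in S, j.2 \in S, j.1 \subset r & j.2 \subset s])) /=; last first.
  move=> z; rewrite inE => /andP[xz zy]; rewrite !pblock_mem //=.
  apply/andP; split; apply/subsetP=> q qp.
    by apply: (hr _ _ _ (pblock_mem (inS (x, z))) _ qp xz); rewrite mem_pblock.
  by apply: (hs _ _ _ (pblock_mem (inS (z, y))) _ qp zy); rewrite mem_pblock.
apply: eq_bigr => -[u v] /and4P[/= uS vS /subsetP ur /subsetP vs]; rewrite -sum1_card.
apply: eq_bigl => z; rewrite !inE; apply/andP/andP => [[_ /eqP[<- <-]]|[zu zv]].
  by rewrite !mem_pblock.
by rewrite ur // vs // (def_pblock tS uS zu) (def_pblock tS vS zv).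
Qed.

Lemma relations_coherent : is_cc S -> coherent [set r | is_rel S r].
Proof.
case/and4P=> pS dS /forall_inP tS /forall_inP cS.
apply/and5P; split; first by rewrite inE.
- apply/forall_inP=> r; rewrite !inE => /(is_relP _ pS) hr; apply/is_relP => // u p q uS pu qu.
  by rewrite !inE; apply: contra; apply: hr uS qu pu.
- apply/forall_inP=> r; rewrite inE => /(is_relP _ pS) hr; apply/forall_inP=> s; rewrite !inE.
  move=> /(is_relP _ pS) hs; apply/is_relP => // u p q uS pu qu; rewrite !inE => /andP[pr ps].
  by rewrite (hr u p) // (hs u p).
- apply/forall_inP=> r; rewrite !inE => /(is_relP _ pS) hr; apply/is_relP => // u p q uS pu qu.
  by rewrite !inE; apply: (hr _ _ _ (tS _ uS)); rewrite inE /= -surjective_pairing.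
- apply/forall_inP=> r; rewrite inE => hr; apply/forall_inP=> s; rewrite inE => hs.
  apply/forallP=> p0; rewrite inE; apply/is_relP => // u p q uS pu qu; rewrite !inE.
  suff -> : cnum r s p.1 p.2 = cnum r s q.1 q.2 by [].
  rewrite !cnum_sum //; apply: eq_bigr => -[v w] /and4P[/= vS wS _ _].
  have /forall_inP/(_ _ wS)/forall_inP/(_ _ uS)/forall_inP h := cS _ vS.
  by have /forall_inP/(_ _ qu)/eqP := h _ pu.
Qed.

Lemma fiber_union_rel (D : {set T}) : fiber_union S D -> is_rel S (diag_of D).
Proof.
case/existsP=> E /andP[/forall_inP ES /eqP <-].
apply/existsP; exists [set diag_of A | A in E]; apply/andP; split.
  by apply/subsetP=> _ /imsetP[A /ES AS ->].
apply/eqP/setP=> p; rewrite in_diag; apply/bigcupP/andP.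
  case=> _ /imsetP[A AE ->]; rewrite in_diag => /andP[-> pA].
  by split=> //; apply/bigcupP; exists A.
case=> pp /bigcupP[A AE pA]; exists (diag_of A); first exact: imset_f.
by rewrite in_diag pp.
Qed.

End Relations.

(** * The complete configuration *)

Section Discrete.
Variable T : finType.

Definition discrete : {set {set T * T}} := [set [set p] | p : T * T].

Lemma discrete_rel (r : {set T * T}) : is_rel discrete r.
Proof.
apply/existsP; exists [set [set p] | p in r]; apply/andP; split.
  by apply/subsetP=> _ /imsetP[p _ ->]; apply: imset_f.
apply/eqP/setP=> p; apply/bigcupP/idP => [[_ /imsetP[q qr ->]]|pr].
  by rewrite in_set1 => /eqP->.
by exists [set p]; [apply: imset_f | rewrite in_set1].
Qed.

Lemma discrete_cc : is_cc discrete.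
Proof.
apply/and4P; split; last 2 first.
- apply/forall_inP=> _ /imsetP[[x y] _ ->]; apply/imsetP; exists (y, x) => //.
  by apply/setP=> -[a b]; rewrite in_transp !in_set1 !xpair_eqE andbC.
- apply/forall_inP=> r _; apply/forall_inP=> s _; apply/forall_inP=> _ /imsetP[p _ ->].
  by apply/forall_inP=> u /set1P->; apply/forall_inP=> v /set1P->.
- apply/and3P; split.
  + apply/eqP/setP=> p; rewrite in_setT; apply/bigcupP.
    by exists [set p]; [apply: imset_f | rewrite in_set1].
  + apply/trivIsetP=> _ _ /imsetP[p _ ->] /imsetP[q _ ->] pq.
    by rewrite disjoints1 in_set1; apply: contraNneq pq => ->.
  + by apply/imsetP=> -[p _ /setP/(_ p)]; rewrite in_set0 set11.
- exact: discrete_rel.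
Qed.

Lemma discrete_fiber_union (D : {set T}) : fiber_union discrete D.
Proof.
apply/existsP; exists [set [set x] | x in D]; apply/andP; split.
  apply/forall_inP=> _ /imsetP[x _ ->]; apply/imsetP; exists (x, x) => //.
  apply/setP=> -[a b]; rewrite in_diag !in_set1 xpair_eqE /=.
  by rewrite andbC; case: eqP => // ->; rewrite eq_sym.
apply/eqP/setP=> x; apply/bigcupP/idP => [[_ /imsetP[y yD ->]]|xD].
  by rewrite in_set1 => /eqP->.
by exists [set x]; [apply: imset_f | rewrite in_set1].
Qed.

Lemma discrete_complete : complete discrete.
Proof. by apply/forall_inP=> _ /imsetP[p _ ->]; rewrite cards1. Qed.

End Discrete.

(** * Groups of odd order and generalized bases *)

Section PermGroup.
Variables (T : finType) (G : {group {perm T}}).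

(** These are the unions of orbits of [G] on pairs, that is, the relations of [Inv G]. *)
Definition invariants : {set {set T * T}} :=
  [set r : {set T * T} | [forall g : {perm T} in G, forall p : T * T in r, (g p.1, g p.2) \in r]].

Lemma invariantP (r : {set T * T}) :
  reflect (forall (g : {perm T}) x y, g \in G -> ((g x, g y) \in r) = ((x, y) \in r))
          (r \in invariants).
Proof.
rewrite inE; apply: (iffP forall_inP) => [h g x y gG|h g gG].
  apply/idP/idP=> [|xy]; last by move: (h _ gG) => /forall_inP/(_ _ xy).
  by move: (h _ (groupVr gG)) => /forall_inP h' /h'; rewrite /= !permK.
by apply/forall_inP=> -[x y] xy; rewrite h.
Qed.

Lemma invariants_coherent : coherent invariants.
Proof.
apply/and5P; split.
- by apply/invariantP=> g x y gG; rewrite !inE /= (inj_eq perm_inj).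
- by apply/forall_inP=> r /invariantP h; apply/invariantP=> g x y gG; rewrite !inE h.
- apply/forall_inP=> r /invariantP h; apply/forall_inP=> s /invariantP h'.
  by apply/invariantP=> g x y gG; rewrite !inE h ?h'.
- by apply/forall_inP=> r /invariantP h; apply/invariantP=> g x y gG; rewrite !inE h.
- apply/forall_inP=> r /invariantP h; apply/forall_inP=> s /invariantP h'.
  apply/forallP=> p; apply/invariantP=> g x y gG; rewrite !inE /=.
  suff -> : cnum r s (g x) (g y) = cnum r s x y by [].
  rewrite /cnum -[RHS](card_imset _ (@perm_inj _ g)); apply: eq_card => z.
  apply/idP/imsetP=> [|[w hw ->]]; last by rewrite inE h // h' //; rewrite inE in hw.
  rewrite inE => hz; exists ((g^-1)%g z); last by rewrite permKV.
  by rewrite inE -(h g) // -(h' g) // permKV.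
Qed.

(** If [g] exchanges [x] and [y], then its odd power [g ^ #|G|], the identity, sends [x] to [y]. *)
Lemma invariants_antisymmetric : odd #|G| -> antisymmetric_on invariants setT.
Proof.
move=> oG x y _ _ e.
pose O := [set (g x, g y) | g : {perm T} in G].
have OF : O \in invariants.
  rewrite inE; apply/forall_inP=> g gG; apply/forall_inP=> _ /imsetP[h hG ->] /=.
  by apply/imsetP; exists (h * g)%g; rewrite ?groupM // !permM.
have : (y, x) \in O.
  rewrite -(same_color_in e OF); apply/imsetP; exists 1%g; rewrite ?group1 //.
  by rewrite !perm1.
case/imsetP=> g gG [gx gy].
have E n : iter n g x = if odd n then y else x.
  by elim: n => //= n ->; case: (odd n).
by have := E #|G|; rewrite -permX expg_cardG // perm1 oG.
Qed.

Lemma invariants_rel r : r \in invariants -> is_rel (Inv G) r.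
Proof.
move/invariantP=> h; apply/existsP; exists [set u in Inv G | u \subset r]; apply/andP; split.
  by apply/subsetP=> u; rewrite inE => /andP[].
apply/eqP/setP=> p; apply/bigcupP/idP => [[u]|pr].
  by rewrite inE => /andP[_ /subsetP]; apply.
exists [set (g p.1, g p.2) | g : {perm T} in G].
  rewrite inE imset_f //; apply/subsetP=> _ /imsetP[g gG ->].
  by rewrite h // -surjective_pairing.
by apply/imsetP; exists 1%g; rewrite ?group1 // !perm1 -surjective_pairing.
Qed.

(** In any fission of [Inv G] where [D] is a union of fibers every point is definable, so every set
    of pairs is a relation; the smallest such fission is therefore [discrete]. *)
Lemma resolving_gen_base D : resolving invariants setT D -> gen_base (Inv G) [set D].
Proof.
case=> _ _ res; apply/existsP; exists (discrete T); rewrite discrete_complete andbT.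
apply/and4P; split; first exact: discrete_cc.
- by apply/forallP=> r; apply/implyP=> _; apply: discrete_rel.
- by apply/forall_inP=> A _; apply: discrete_fiber_union.
apply/forallP=> S; apply/implyP=> /and3P[cS /forallP fS /forall_inP/(_ _ (set11 D)) DS].
have cR := relations_coherent cS.
have sub : invariants \subset [set r | is_rel S r].
  by apply/subsetP=> r /invariants_rel hr; rewrite inE; have := fS r; rewrite hr.
have single x : definable [set r | is_rel S r] [set x].
  by apply: res; rewrite ?in_setT //; rewrite /definable inE; apply: fiber_union_rel.
apply/forallP=> r; apply/implyP=> _.
suff : r \in [set r | is_rel S r] by rewrite inE.
apply: coh_invariant => // p q e.
suff -> : p = q by [].
have h1 := definable_fst cR (single p.1) e; have h2 := definable_snd cR (single p.2) e.
move: h1 h2; rewrite !in_set1 !eqxx => /esym/eqP h1 /esym/eqP h2.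
by rewrite [p]surjective_pairing [q]surjective_pairing h1 h2.
Qed.

End PermGroup.

Lemma gb_le (T : finType) (S : {set {set T * T}}) Pi : gen_base S Pi -> gb S <= #|Pi|.
Proof.
rewrite /gb => gPi; have: Pi \in index_enum {set {set T}} by rewrite mem_index_enum.
elim: (index_enum _) => // A s IHs; rewrite in_cons big_cons => /orP[/eqP<-|/IHs h].
  by rewrite gPi geq_minl.
by case: ifP => // _; rewrite geq_min h orbT.
Qed.

Theorem theorem1p2 (T : finType) (G : {group {perm T}}) :
  odd #|G| -> gb (Inv G) <= 1.
Proof.
move=> oG; have cF := invariants_coherent G.
have [D rD] := resolving_exists cF (definableT cF) (invariants_antisymmetric oG).
by rewrite -(cards1 D) gb_le ?resolving_gen_base.
Qed.
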